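(* Let $G$ be a non-compact semisimple Lie group with Cartan decomposition $\mathfrak{g}=\mathfrak{k}+\mathfrak{p}$ of its Lie algebra, let $G^{\mathbb{C}}$ be its complexification and let $U$ be the compact subgroup of $G^{\mathbb{C}}$ with Lie algebra $\mathfrak{u}=\mathfrak{k}+i\mathfrak{p}$. Let $f:W\to\mathbb{C}$ be a real analytic complex-valued function on an open subset $W$ of $G$, and let $f^*:W^*\to\mathbb{C}$ be its dual function, defined on an open subset $W^*$ of $U$. Then, for a positive integer $r$, $f:W\to\mathbb{C}$ is proper $r$-harmonic if and only if its dual $f^*:W^*\to\mathbb{C}$ is proper $r$-harmonic.
   Context: Setting: $\mathfrak{k}$ is the Lie algebra of a maximal compact subgroup $K$ of $G$. The group $G^{\mathbb{C}}$ and its subgroups are equipped with a left-invariant semi-Riemannian metric which is a multiple of the Killing form by a negative constant; then the subgroup $U$ of $G^{\mathbb{C}}$ is Riemannian and $G$ is semi-Riemannian. Dual function: a real analytic function $f:W\to\mathbb{C}$ from an open subset $W$ of $G$ extends uniquely to a holomorphic function $f^{\mathbb{C}}:W^{\mathbb{C}}\to\mathbb{C}$ from some open subset $W^{\mathbb{C}}$ of $G^{\mathbb{C}}$. By restricting $f^{\mathbb{C}}$ to $U\cap W^{\mathbb{C}}$ one obtains a real analytic function $f^*:W^*\to\mathbb{C}$ on some open subset $W^*$ of $U$. The function $f^*$ is called the dual function of $f$. For a complex-valued function $f$ on an open subset of a semi-Riemannian manifold, $\tau(f)=\mathrm{div}(\nabla f)$ is the Laplace-Beltrami operator (extended complex-linearly),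 $\tau^0(f)=f$ and $\tau^r(f)=\tau(\tau^{r-1}(f))$. The function $f$ is proper $r$-harmonic if $\tau^r(f)=0$ and $\tau^{r-1}(f)$ does not vanish identically.
   Formalization: It is additionally assumed that every connected component of the domain W^C of the holomorphic extension meets U (for connected W: that W^* is non-empty); otherwise W^* may be empty, e.g. for f = 1 on a small W away from U, and the equivalence fails. *)

(* Defs.v *)
From HB Require Import structures.
From mathcomp Require Import all_boot all_order all_algebra.
From mathcomp Require Import all_classical all_reals all_analysis.
From mathcomp Require Import complex.

Set Implicit Arguments.
Unset Strict Implicit.
Unset Printing Implicit Defensive.

Import Order.TTheory GRing.Theory Num.Theory numFieldNormedType.Exports.

Local Open Scope classical_set_scope.
Local Open Scope ring_scope.

(** * Analytic functions of several variables

    The map [i : K -> L] embeds the field of the variables into the field of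
    the values: [idfun] on R for real-valued real analytic functions, [idfun]
    on R[i] for holomorphic functions (in the sense of Weierstrass: locally the
    sum of a convergent power series), and [real_complex R] for complex-valued
    real analytic functions. *)

Section Analytic.
Variables (K L : numFieldType) (i : K -> L).

Definition monomial n (al : {ffun 'I_n -> nat}) (x : 'rV[K]_n) : L :=
  \prod_(j < n) i (x 0 j) ^+ al j.

(* partial sums over the multi-indices with all entries < N; for absolutely
   convergent families the order of summation does not matter *)
Definition box_sum n (u : {ffun 'I_n -> nat} -> L) (N : nat) : L :=
  \sum_(al : {ffun 'I_n -> 'I_N}) u [ffun j => nat_of_ord (al j)].

Definition analytic_at n (F : 'rV[K]_n -> L) (a : 'rV[K]_n) : Prop :=
  exists c : {ffun 'I_n -> nat} -> L, \forall x \near a,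
    cvgn (box_sum (fun al => `|c al * monomial al (x - a)|)) /\
    box_sum (fun al => c al * monomial al (x - a)) @ \oo --> F x.

Definition analytic_map_at n p (F : 'rV[K]_n -> 'rV[L]_p) (a : 'rV[K]_n) :=
  forall j, analytic_at (fun x => F x 0 j) a.

End Analytic.

(** * Lie groups over K = R or K = R[i] *)

Record chart (K : numFieldType) (n : nat) (T : topologicalType) := Chart {
  chart_dom : set T;
  chart_fun : T -> 'rV[K]_n;
  chart_inv : 'rV[K]_n -> T;
  open_chart_dom : open chart_dom;
  open_chart_img : open (chart_fun @` chart_dom);
  chart_funK : forall x, chart_dom x -> chart_inv (chart_fun x) = x;
  chart_fun_continuous : forall x, chart_dom x -> {for x, continuous chart_fun};
  chart_inv_continuous :
    forall x, chart_dom x -> {for chart_fun x, continuous chart_inv} }.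

(* The atlas is the family [chart_at], with a chosen chart around each point.
   In particular [chart_at 1] identifies the tangent space at 1, that is, the
   Lie algebra, with K^n. *)
HB.mixin Record isLieGroup (K : numFieldType) (n : nat) G
    of Group G & Topological G := {
  lie_hausdorff : hausdorff_space G;
  lie_second_countable : @second_countable G;
  chart_at : G -> chart K n G;
  chart_at_dom : forall g, chart_dom (chart_at g) g;
  chart_compat : forall g h x,
    chart_dom (chart_at g) x -> chart_dom (chart_at h) x ->
    analytic_map_at idfun (chart_fun (chart_at h) \o chart_inv (chart_at g))
      (chart_fun (chart_at g) x);
  lie_mulg_continuous : continuous (fun xy : G * G => (xy.1 * xy.2)%g);
  lie_mulg_analytic : forall g h,
    analytic_map_at idfun
      (fun z : 'rV[K]_(n + n) => chart_fun (chart_at (g * h)%g)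
         (chart_inv (chart_at g) (lsubmx z) *
          chart_inv (chart_at h) (rsubmx z))%g)
      (row_mx (chart_fun (chart_at g) g) (chart_fun (chart_at h) h));
  lie_invg_continuous : continuous (fun x : G => x^-1%g);
  lie_invg_analytic : forall g,
    analytic_map_at idfun
      (fun z => chart_fun (chart_at g^-1%g) (chart_inv (chart_at g) z)^-1%g)
      (chart_fun (chart_at g) g) }.

#[short(type="lieGroupType")]
HB.structure Definition LieGroup (K : numFieldType) (n : nat) :=
  {G of isLieGroup K n G & Group G & Topological G}.

Definition chart1 (K : numFieldType) n (G : lieGroupType K n) : chart K n G :=
  chart_at (1%g : G).

(* [lderiv i v f] is the derivative of f along the left-invariant vector field
   whose value at 1 is v. *)
Definition lderiv (K L : numFieldType) (i : K -> L) n (G : lieGroupType K n)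
    (v : 'rV[K]_n) (f : G -> L) (g : G) : L :=
  lim ((i h)^-1 *
       (f (g * chart_inv (chart1 G) (chart_fun (chart1 G) 1%g + h *: v))%g - f g)
         @[h --> (0 : K)^']).

Definition analytic_on (K L : numFieldType) (i : K -> L) n
    (G : lieGroupType K n) (W : set G) (f : G -> L) : Prop :=
  forall g, W g ->
    analytic_at i (f \o chart_inv (chart_at g)) (chart_fun (chart_at g) g).

Section LieAlgebra.
Variables (K : numFieldType) (n : nat) (G : lieGroupType K n).

(* The commutator of the left-invariant vector fields extending v and w is
   evaluated at 1 on the coordinate functions of [chart1]. *)
Definition lie_bracket (v w : 'rV[K]_n) : 'rV[K]_n :=
  let x_ j (g : G) : K := chart_fun (chart1 G) g 0 j in
  \row_j (lderiv idfun v (lderiv idfun w (x_ j)) 1%g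
          - lderiv idfun w (lderiv idfun v (x_ j)) 1%g).

Definition killing (v w : 'rV[K]_n) : K :=
  \tr (lin1_mx (lie_bracket v) *m lin1_mx (lie_bracket w)).

Definition semisimple : Prop :=
  forall v, (forall w, killing v w = 0) -> v = 0.

Definition subgroup (H : set G) : Prop :=
  H 1%g /\ forall x y, H x -> H y -> H (x * y^-1)%g.

Definition maximal_compact (H : set G) : Prop :=
  [/\ subgroup H, compact H &
      forall H', subgroup H' -> compact H' -> H `<=` H' -> H' = H].

End LieAlgebra.

Section RealLieAlgebra.
Variables (R : realType) (n : nat) (G : lieGroupType R n).

(* initial velocities of the one-parameter subgroups contained in H *)
Definition lie_algebra_of (H : set G) (v : 'rV[R]_n) : Prop :=
  exists gamma : R -> G,
    [/\ forall s t, gamma (s + t) = (gamma s * gamma t)%g,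
        continuous gamma,
        is_derive (0 : R) (1 : R) (chart_fun (chart1 G) \o gamma) v &
        forall t, H (gamma t)].

(* The subspaces k and p are the row spaces of [kk] and [pp]. *)
Definition cartan_decomposition (kk pp : 'M[R]_n) : Prop :=
  let br := @lie_bracket R n G in
  [/\ (kk + pp == 1%:M)%MS /\ (kk :&: pp)%MS = 0,
      forall x y, (x <= kk)%MS -> (y <= kk)%MS -> (br x y <= kk)%MS,
      forall x y, (x <= kk)%MS -> (y <= pp)%MS -> (br x y <= pp)%MS,
      forall x y, (x <= pp)%MS -> (y <= pp)%MS -> (br x y <= kk)%MS &
      (forall x, (x <= kk)%MS -> x != 0 -> killing G x x < 0) /\
      (forall x, (x <= pp)%MS -> x != 0 -> 0 < killing G x x)].

End RealLieAlgebra.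

(** * The Laplace-Beltrami operator of a left-invariant metric

    [met] is the value of the metric on the Lie algebra.  Vector fields are
    given by their components in the left-invariant frame e_a which is the
    standard basis at 1. *)

Section LaplaceBeltrami.
Variables (R : realType) (n : nat) (G : lieGroupType R n).
Variable met : 'rV[R]_n -> 'rV[R]_n -> R.

Let e (a : 'I_n) : 'rV[R]_n := delta_mx 0 a.
Let br := @lie_bracket R n G.

Definition gram : 'M[R]_n := \matrix_(a, b) met (e a) (e b).

(* Levi-Civita connection: nabla_{e_a} e_b = \sum_c [christoffel a b c] e_c.
   By Koszul's formula, in which met (e_a) (e_b) is constant,
   2 <nabla_X Y, Z> = <[X, Y], Z> - <[Y, Z], X> + <[Z, X], Y>. *)
Definition christoffel (a b c : 'I_n) : R :=
  2^-1 * \sum_d invmx gram c d *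
    (met (br (e a) (e b)) (e d) - met (br (e b) (e d)) (e a)
     + met (br (e d) (e a)) (e b)).

Definition gradient (f : G -> R[i]) (c : 'I_n) (g : G) : R[i] :=
  \sum_d (invmx gram c d)%:C%C * lderiv (real_complex R) (e d) f g.

(* trace of X |-> nabla_X V *)
Definition divergence (V : 'I_n -> G -> R[i]) (g : G) : R[i] :=
  \sum_a (lderiv (real_complex R) (e a) (V a) g
          + \sum_b (christoffel a b a)%:C%C * V b g).

Definition laplace_beltrami (f : G -> R[i]) : G -> R[i] :=
  divergence (gradient f).

(* Here W is open, so that only the restriction of f to W matters. *)
Definition proper_harmonic (r : nat) (W : set G) (f : G -> R[i]) : Prop :=
  (forall g, W g -> iter r laplace_beltrami f g = 0) /\
  ~ (forall g, W g -> iter r.-1 laplace_beltrami f g = 0).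

End LaplaceBeltrami.

(** * Real Lie subgroups of a complex Lie group *)

Section RealSubgroup.
Variables (R : realType) (n m : nat).
Variables (GC : lieGroupType R[i] m) (G : lieGroupType R n) (iota : G -> GC).

(* differential of iota at 1 *)
Definition dincl (v : 'rV[R]_n) : 'rV[R[i]]_m :=
  \row_j lderiv (real_complex R) v
           (fun g : G => chart_fun (chart1 GC) (iota g) 0 j) 1%g.

Definition lie_subgroup : Prop :=
  [/\ injective iota,
      {morph iota : x y / (x * y)%g},
      continuous iota,
      forall g, analytic_map_at (real_complex R)
        (chart_fun (chart_at (iota g)) \o iota \o chart_inv (chart_at g))
        (chart_fun (chart_at g) g) &
      forall v, dincl v = 0 -> v = 0].

(* GC contains G, and its Lie algebra is the direct sum of g and ig. *)
Definition complexification : Prop :=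
  lie_subgroup /\
  forall z, exists! xy : 'rV[R]_n * 'rV[R]_n,
    z = dincl xy.1 + 'i%C *: dincl xy.2.

(* The Killing form of GC regarded as a real Lie group is twice the real part
   of the complex one; the factor 2 is absorbed by [lambda]. *)
Definition killing_metric (lambda : R) (v w : 'rV[R]_n) : R :=
  - lambda * complex.Re (killing GC (dincl v) (dincl w)).

End RealSubgroup.

(* [fs], on [Ws], is the dual function of [f], on [W].  That every connected
   component of [WC] meets W makes the extension fC unique; that every
   component also meets U excludes the degenerate case in which f is not
   determined by its dual (for instance [Ws] empty). *)
Definition dual_function (R : realType) (m n p : nat)
    (GC : lieGroupType R[i] m) (G : lieGroupType R n) (U : lieGroupType R p)
    (iG : G -> GC) (iU : U -> GC)
    (W : set G) (f : G -> R[i]) (Ws : set U) (fs : U -> R[i]) : Prop :=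
  exists (WC : set GC) (fC : GC -> R[i]),
    [/\ open WC /\ analytic_on idfun WC fC,
        forall g, W g -> WC (iG g) /\ fC (iG g) = f g,
        forall z, WC z -> connected_component WC z `&` iG @` W !=set0 /\
                          connected_component WC z `&` range iU !=set0,
        Ws = iU @^-1` WC &
        forall u, Ws u -> fs u = fC (iU u)].

(* Main.v *)
Require Import Defs.
From mathcomp Require Import all_boot all_order all_algebra all_solvable all_field.
From mathcomp Require Import all_classical all_reals all_analysis.
From mathcomp Require Import complex.
From mathcomp Require Import zify ring lra.

Set Implicit Arguments.
Unset Strict Implicit.
Unset Printing Implicit Defensive.

Import Order.TTheory GRing.Theory Num.Theory numFieldNormedType.Exports.
Local Open Scope classical_set_scope.
Local Open Scope ring_scope.

(** The idea is Weyl's unitary trick.  Both [G] and [U] are real forms of the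
    same complex group [GC]: their tangent vectors at 1, read in the Lie algebra
    of [GC], form two complex bases of it.  For a holomorphic function F on [GC]
    whose restriction to a real form is f, the derivative of f along a
    left-invariant field of the real form is the restriction of the derivative
    of F along the corresponding holomorphic left-invariant field
    ([natural_lderiv]).  The Laplace-Beltrami operator of the real form is built
    from such derivatives, the Lie bracket and the Killing form.  It is
      sum_ad g^ad e_a e_d - sum_bd tr (ad e_b) g^bd e_d,
    because the contracted Christoffel symbols reduce to traces of the adjoint
    representation ([christoffel_trace]).  The Killing form of the real form is
    the restriction of the complex one ([killing_real]), and the displayed
    expression does not depend on the complex basis; so it is the restriction of
    one holomorphic operator on [GC], the same for [G] and [U]
    ([natural_laplacian]).

    Hence tau^k f and tau^k f* are restrictions of the same holomorphic function
    h on the domain WC of the extension.  By the identity theorem, either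
    restriction vanishes if and only if h does ([vanish_real_form]): if h
    vanishes on a real form, then so do its derivatives along the tangent
    vectors of the real form, and, as these span, all iterated left-invariant
    derivatives of h vanish there; the set of points of WC with this property is
    open and closed, and every component of WC meets both real forms.

    The analysis rests on one class of functions, the locally uniform limits of
    polynomials on complex coordinate spaces ([holo]).  It contains the complex
    extensions of all real or complex analytic functions ([analytic_holo]), it
    is stable under products and derivatives, and Cauchy's estimates for
    polynomials, in which an average over roots of unity replaces the circle
    integral ([coef_bound]), give quadratic Taylor remainders ([holo_qdiff]), the
    symmetry of second derivatives ([gradC]) and the vanishing of functions that
    are flat at a point ([flat_zero]).  Left-invariant derivations preserve the
    class because in a chart their coefficients are derivatives of the
    multiplication map ([frame_exists]).  Flatness along an invertible frame is
    turned into vanishing to infinite order by induction on the order, with the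
    mean value inequality ([flat_family]).

    The bracket is defined through the coordinate functions only; that it
    computes commutators on all functions, which makes [dincl] a morphism of Lie
    algebras ([dincl_bracket]), follows from the symmetry of second
    derivatives ([commutator_derivation]). *)

Local Notation cmod := Normc.normc.

(** * The modulus of complex numbers *)

Section Modulus.
Variable R : realType.
Implicit Types z w : R[i].

Lemma cmodE z : `|z| = (cmod z)%:C%C. Proof. by []. Qed.

Lemma cmod_ge0 z : 0 <= cmod z.
Proof. by rewrite -ler0c -cmodE normr_ge0. Qed.

Lemma cmod_real (x : R) : cmod x%:C%C = `|x|.
Proof. by rewrite /= expr0n addr0 sqrtr_sqr. Qed.

Lemma cmodX z n : cmod (z ^+ n) = cmod z ^+ n.
Proof.
by elim: n => [|n IH]; rewrite ?expr0 ?Normc.normc1// !exprS Normc.normcM IH.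
Qed.

Lemma le_cmodB z w : cmod (z - w) <= cmod z + cmod w.
Proof. by rewrite (le_trans (le_normcD _ _))// normcN. Qed.

Lemma cmod_le0 z : cmod z <= 0 -> z = 0.
Proof. by rewrite le_eqVlt ltNge cmod_ge0 orbF => /eqP/Normc.eq0_normc. Qed.

Lemma cmod_sum (I : Type) (r : seq I) (P : pred I) (F : I -> R[i]) :
  cmod (\sum_(k <- r | P k) F k) <= \sum_(k <- r | P k) cmod (F k).
Proof.
elim/big_ind2: _ => [|x1 x2 y1 y2 h1 h2|//]; first by rewrite Normc.normc0.
by rewrite (le_trans (le_normcD _ _))// lerD.
Qed.

Lemma cmod_eq1 z n : (0 < n)%N -> z ^+ n = 1 -> cmod z = 1.
Proof.
move=> n0 /(congr1 (@Normc.normc R)); rewrite cmodX Normc.normc1 => /eqP.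
by rewrite pexpr_eq1 ?cmod_ge0// => /eqP.
Qed.

Lemma real_limit_rate (x w : nat -> R) :
  (forall N M, (N <= M)%N -> `|x M - x N| <= w N) ->
  exists l, forall N, `|l - x N| <= w N.
Proof.
move=> xw; pose S := [set x N - w N | N in [set: nat]].
have w0 N : 0 <= w N by apply: le_trans (xw N N (leqnn _)).
have SB M : ubound S (x M + w M).
  move=> _ [N _ <-]; have [NM|/ltnW MN] := leqP N M.
    by have := xw _ _ NM; rewrite ler_norml; have := w0 M; have := w0 N; lra.
  by have := xw _ _ MN; rewrite ler_norml; have := w0 M; have := w0 N; lra.
have SS : has_sup S by split; [exists (x 0%N - w 0%N), 0%N | exists (x 0%N + w 0%N)].
(* The intervals of radius [w N] around [x N] pairwise meet. *)
exists (sup S) => N; rewrite ler_norml.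
have h1 : x N - w N <= sup S by apply: ub_le_sup; [exact: SS.2|exists N].
have h2 : sup S <= x N + w N by apply: ge_sup => //; exact: SS.1.
by lra.
Qed.

Lemma ReB z w : complex.Re (z - w) = complex.Re z - complex.Re w.
Proof. by case: z w => [a b] [c d]. Qed.

Lemma ImB z w : complex.Im (z - w) = complex.Im z - complex.Im w.
Proof. by case: z w => [a b] [c d]. Qed.

Lemma cmod_Re z : `|complex.Re z| <= cmod z.
Proof. by rewrite -lecR -cmodE normc_ge_Re. Qed.

Lemma cmod_Im z : `|complex.Im z| <= cmod z.
Proof.
case: z => a b /=; rewrite -sqrtr_sqr ler_wsqrtr//.
by rewrite lerDr sqr_ge0.
Qed.

Lemma cmod_le z : cmod z <= `|complex.Re z| + `|complex.Im z|.
Proof.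
rewrite {1}[z]complexE (le_trans (le_normcD _ _))// cmod_real lerD//.
rewrite Normc.normcM cmod_real; case: z => a b /=.
by rewrite expr0n expr1n add0r sqrtr1 mul1r.
Qed.

(** Completeness of the complex plane, in a quantitative form.  The factor 2 is
    lost in treating real and imaginary parts separately. *)
Lemma complex_limit_rate (x : nat -> R[i]) (w : nat -> R) :
  (forall N M, (N <= M)%N -> cmod (x M - x N) <= w N) ->
  exists l, forall N, cmod (l - x N) <= 2 * w N.
Proof.
move=> xw.
have [a ha] : exists a, forall N, `|a - complex.Re (x N)| <= w N.
  apply: real_limit_rate => N M NM.
  by rewrite -ReB (le_trans (cmod_Re _))// xw.
have [b hb] : exists b, forall N, `|b - complex.Im (x N)| <= w N.
  apply: real_limit_rate => N M NM.
  by rewrite -ImB (le_trans (cmod_Im _))// xw.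
exists (a +i* b)%C => N; apply: le_trans (cmod_le _) _.
by rewrite ReB ImB /=; have := ha N; have := hb N; lra.
Qed.

End Modulus.

(** * Cauchy's estimates for polynomials *)

Section CoefficientBound.
Variable R : realType.
Implicit Types (p : {poly R[i]}) (k n : nat).

Lemma exists_prim_root n : (0 < n)%N -> {z : R[i] | n.-primitive_root z}.
Proof.
pose p : {poly R[i]} := 'X^n - 1; have [r Dp] := closed_field_poly_normal p.
move=> n_gt0; apply/sigW.
rewrite (monicP _) ?monicXnsubC // scale1r in Dp.
have rn1 : all n.-unity_root r by apply/allP=> z; rewrite -root_prod_XsubC -Dp.
have sz_r : (n < (size r).+1)%N.
  by rewrite -(size_prod_XsubC r id) -Dp size_XnsubC.
have [|z] := hasP (has_prim_root n_gt0 rn1 _ sz_r); last by exists z.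
by rewrite -separable_prod_XsubC -Dp separable_Xn_sub_1 // pnatr_eq0 -lt0n.
Qed.

Lemma sum_prim_root (w : R[i]) n (e : nat) : n.-primitive_root w ->
  (0 < e < n)%N -> \sum_(j < n) (w ^+ e) ^+ j = 0.
Proof.
move=> pw /andP[e0 en]; have : w ^+ e - 1 != 0.
  rewrite subr_eq0 -(prim_order_dvd pw); apply/negP => /(dvdn_leq e0).
  by rewrite leqNgt en.
move=> /mulfI; apply; rewrite mulr0 -subrX1 -exprM mulnC exprM.
by rewrite (prim_expr_order pw) expr1n subrr.
Qed.

(** Cauchy's estimate for the coefficients of a polynomial, the circle integral
    being replaced by the average over roots of unity of an order that exceeds
    the degree. *)
Lemma coef_bound p (rho B : R) k : 0 < rho ->
  (forall t, cmod t = rho -> cmod p.[t] <= B) -> cmod p`_k * rho ^+ k <= B.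
Proof.
move=> rho0 pB.
have B0 : 0 <= B.
  by apply: le_trans (cmod_ge0 _) (pB rho%:C%C _); rewrite cmod_real gtr0_norm.
have [ks|ks] := leqP (size p) k; first by rewrite nth_default// Normc.normc0 mul0r.
(* Roots of unity of order [size p] separate all exponents that occur in [p]. *)
set n := size p in ks *; have n0 : (0 < n)%N by exact: leq_ltn_trans ks.
have [w pw] := exists_prim_root n0.
have w1 j : cmod (w ^+ j) = 1.
  by rewrite cmodX (cmod_eq1 n0 (prim_expr_order pw)) expr1n.
set r := rho%:C%C.
have term (l : nat) : \sum_(j < n) (w ^+ (n - k)) ^+ j * (p`_l * (r * w ^+ j) ^+ l)
    = p`_l * r ^+ l * \sum_(j < n) (w ^+ (n - k + l)) ^+ j.
  rewrite mulr_sumr; apply: eq_bigr => j _; rewrite exprMn mulrCA -!mulrA.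
  congr (_ * _); rewrite mulrCA; congr (_ * _).
  by rewrite -!exprM -exprD (mulnC j) -mulnDl.
have avg : \sum_(j < n) (w ^+ (n - k)) ^+ j * p.[r * w ^+ j] =
           n%:R * (p`_k * r ^+ k).
  under eq_bigr do rewrite horner_coef mulr_sumr.
  rewrite exchange_big (bigD1 (Ordinal ks))//= term [X in _ + X]big1 ?addr0.
    rewrite subnK 1?ltnW// (prim_expr_order pw).
    under eq_bigr do rewrite expr1n.
    by rewrite sumr_const card_ord mulrC.
  move=> l lk; rewrite term; apply/eqP; rewrite mulf_eq0; apply/orP; right; apply/eqP.
  have lk' : (l != k :> nat) by [].
  have ln := ltn_ord l; have [lk2|kl] := ltnP l k.
    have aux (a b c : nat) : (a < b < c -> 0 < c - b + a < c)%N by lia.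
    by apply: sum_prim_root => //; apply: aux; rewrite lk2.
  have -> : w ^+ (n - k + l) = w ^+ (l - k).
    have aux (a b c : nat) : (b <= a -> b <= c -> c - b + a = c + (a - b))%N by lia.
    rewrite aux//; last exact: ltnW.
    by rewrite exprD (prim_expr_order pw) mul1r.
  apply: sum_prim_root => //; rewrite subn_gt0 ltn_neqAle eq_sym lk' kl /=.
  exact: leq_ltn_trans (leq_subr _ _) ln.
have := congr1 (@Normc.normc R) avg; rewrite Normc.normcM => e.
have nC : cmod (n%:R : R[i]) = n%:R.
  by have := @normr_nat R[i] n; rewrite cmodE => /(congr1 (@complex.Re R)) /= ->;
     rewrite -(rmorph_nat (real_complex R)).
have nR : 0 < n%:R :> R by rewrite ltr0n.
rewrite -(ler_pM2l nR).
have -> : cmod p`_k * rho ^+ k = cmod (p`_k * r ^+ k).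
  by rewrite Normc.normcM cmodX cmod_real gtr0_norm.
rewrite -nC -e nC; apply: le_trans (cmod_sum _ _ _) _.
have -> : n%:R * B = \sum_(j < n) B by rewrite sumr_const card_ord mulr_natl.
apply: ler_sum => j _.
rewrite Normc.normcM -exprM w1 mul1r pB// Normc.normcM w1 mulr1 cmod_real.
by rewrite gtr0_norm.
Qed.

Lemma geometric_le2 (x : R) n : 0 <= x <= 2^-1 -> \sum_(k < n) x ^+ k <= 2.
Proof.
move=> /andP[x0 x1].
have h : (1 - x) * \sum_(k < n) x ^+ k <= 1.
  by rewrite -opprB mulNr -subrX1 opprB gerBl exprn_ge0.
have S0 : 0 <= \sum_(k < n) x ^+ k by apply: sumr_ge0 => k _; exact: exprn_ge0.
by nra.
Qed.

(** By Cauchy's estimates the coefficients are dominated by a geometric series,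
    whose ratio is at most one half because the radius is at least 2. *)
Lemma poly_tail p (rho B : R) m : 2 <= rho ->
  (forall t, cmod t = rho -> cmod p.[t] <= B) ->
  cmod (p.[1] - \sum_(k < m) p`_k) <= 2 * B * rho^-1 ^+ m.
Proof.
move=> rho2 pB; have rho0 : 0 < rho by lra.
have B0 : 0 <= B.
  by apply: le_trans (cmod_ge0 _) (pB rho%:C%C _); rewrite cmod_real gtr0_norm.
have -> : p.[1] - \sum_(k < m) p`_k = \sum_(k < size p) p`_(m + k).
  rewrite (@horner_coef_wide _ (m + size p)) ?leq_addl//.
  by under eq_bigr do rewrite expr1n mulr1; rewrite big_split_ord addrAC subrr add0r.
apply: le_trans (cmod_sum _ _ _) _.
apply: (@le_trans _ _ (\sum_(k < size p) B * rho^-1 ^+ m * rho^-1 ^+ k)).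
  apply: ler_sum => k _; rewrite -mulrA -exprD exprVn ler_pdivlMr ?exprn_gt0//.
  exact: coef_bound.
rewrite -mulr_sumr.
have : \sum_(k < size p) rho^-1 ^+ k <= 2.
  apply: geometric_le2; rewrite invr_ge0 ltW//= lef_pV2 ?posrE//.
have : 0 <= B * rho^-1 ^+ m by rewrite mulr_ge0// exprn_ge0// invr_ge0 ltW.
by nra.
Qed.

Lemma poly_taylor2 p (rho B : R) : 2 <= rho ->
  (forall t, cmod t = rho -> cmod p.[t] <= B) ->
  cmod (p.[1] - p`_0 - p`_1) <= 2 * B * rho^-1 ^+ 2.
Proof.
move=> rho2 pB; have := poly_tail 2 rho2 pB.
by rewrite big_ord_recl big_ord1 opprD addrA.
Qed.

(** Cauchy's estimates for the derivative bound the coefficients of the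
    polynomial itself; the circle of radius 2 makes their sum converge at 1. *)
Lemma poly_mean_value p (eta : R) :
  (forall t, cmod t = 2 -> cmod (p^`()).[t] <= eta) ->
  cmod (p.[1] - p.[0]) <= 2 * eta.
Proof.
move=> pe.
have e0 : 0 <= eta.
  by apply: le_trans (cmod_ge0 _) (pe 2%:C%C _); rewrite cmod_real gtr0_norm.
rewrite horner_coef0 (@horner_coef_wide _ (size p).+1)// big_ord_recl /=.
rewrite mulr1 addrAC subrr add0r; apply: le_trans (cmod_sum _ _ _) _.
apply: (@le_trans _ _ (\sum_(k < size p) eta * 2^-1 ^+ k)).
  apply: ler_sum => k _; rewrite expr1n mulr1.
  have := @coef_bound _ 2 eta k ltac:(by []) pe.
  rewrite exprVn ler_pdivlMr ?exprn_gt0//; apply: le_trans.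
  rewrite ler_pM2r ?exprn_gt0// coef_deriv /bump/= add1n.
  by rewrite normcMn mulrS lerDl mulrn_wge0// cmod_ge0.
rewrite -mulr_sumr.
have : \sum_(k < size p) (2^-1 : R) ^+ k <= 2.
  by apply: geometric_le2; apply/andP; split; lra.
by nra.
Qed.

End CoefficientBound.

(** * Boxes and polynomials in several variables *)

Section Boxes.
Variables (R : realType).

Definition inbox n (s : R) (k : 'rV[R[i]]_n) := forall j, cmod (k 0 j) <= s.

Definition dot n (k d : 'rV[R[i]]_n) : R[i] := \sum_j k 0 j * d 0 j.

Lemma inboxW n s s' (k : 'rV[R[i]]_n) : s <= s' -> inbox s k -> inbox s' k.
Proof. by move=> ss' ks j; apply: le_trans (ks j) ss'. Qed.

Lemma inboxD n s t (k l : 'rV[R[i]]_n) :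
  inbox s k -> inbox t l -> inbox (s + t) (k + l).
Proof.
move=> ks lt j; rewrite mxE; apply: le_trans (le_normcD _ _) _.
by apply: lerD.
Qed.

Lemma inboxZ n s (c : R[i]) (k : 'rV[R[i]]_n) :
  inbox s k -> inbox (cmod c * s) (c *: k).
Proof. by move=> ks j; rewrite mxE Normc.normcM ler_wpM2l ?cmod_ge0. Qed.

Lemma inbox0 n s : 0 <= s -> inbox s (0 : 'rV[R[i]]_n).
Proof. by move=> s0 j; rewrite mxE Normc.normc0. Qed.

Lemma inbox_exists n (k : 'rV[R[i]]_n) : exists2 s, 0 < s & inbox s k.
Proof.
exists (1 + \sum_j cmod (k 0 j)).
  by rewrite ltr_pwDl// sumr_ge0// => j _; exact: cmod_ge0.
move=> j; rewrite (bigD1 j)//= addrCA lerDl addr_ge0//.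
by apply: sumr_ge0 => l _; exact: cmod_ge0.
Qed.

Lemma dotBr n (k d e : 'rV[R[i]]_n) : dot k d - dot k e = dot k (d - e).
Proof.
by rewrite /dot -sumrB; apply: eq_bigr => j _; rewrite !mxE mulrBr.
Qed.

Lemma dotZl n c (k d : 'rV[R[i]]_n) : dot (c *: k) d = c * dot k d.
Proof. by rewrite /dot mulr_sumr; apply: eq_bigr => j _; rewrite mxE mulrA. Qed.

Lemma dot_delta n j (d : 'rV[R[i]]_n) : dot (delta_mx 0 j) d = d 0 j.
Proof.
rewrite /dot (bigD1 j)//= big1 ?addr0; first by rewrite mxE !eqxx mul1r.
by move=> l lj; rewrite mxE (negbTE lj) andbF mul0r.
Qed.

Lemma cmod_dot n s t (k d : 'rV[R[i]]_n) : 0 <= s ->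
  inbox s k -> inbox t d -> cmod (dot k d) <= n%:R * (s * t).
Proof.
move=> s0 ks dt; apply: le_trans (cmod_sum _ _ _) _.
have -> : n%:R * (s * t) = \sum_(j < n) s * t by rewrite sumr_const card_ord mulr_natl.
apply: ler_sum => j _.
by rewrite Normc.normcM ler_pM ?cmod_ge0.
Qed.

(** The field of the variables: the real or the complex numbers, embedded
    isometrically into the complex numbers.  The last condition makes small
    radii available in [K]. *)
Definition isometric (K : numFieldType) (i : K -> R[i]) : Prop :=
  (forall x, `|i x| = i `|x|) /\ forall d : R, exists e, i e = d%:C%C.

Lemma isometric_id : isometric (@idfun R[i]).
Proof. by split=> // d; exists d%:C%C. Qed.

Lemma isometric_real : isometric (real_complex R).
Proof. by split=> [x|d]; [rewrite cmodE cmod_real | exists d]. Qed.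

Lemma isometric_gt0 (K : numFieldType) (i : {rmorphism K -> R[i]}) x :
  isometric i -> (0 < i x) = (0 < x).
Proof.
move=> [ni _]; have ge0 y : (0 <= i y) = (0 <= y).
  rewrite -[LHS]eqr_norm_id -[RHS]eqr_norm_id ni.
  by rewrite (inj_eq (fmorph_inj i)).
by rewrite !lt0r ge0 fmorph_eq0.
Qed.

Lemma nbhs_box (K : numFieldType) (i : {rmorphism K -> R[i]}) n
    (a : 'rV[K]_n) (P : set 'rV[K]_n) : isometric i ->
  nbhs a P <->
  exists2 d : R, 0 < d & forall x, inbox d (map_mx i (x - a)) -> P x.
Proof.
move=> ii; have [ni si] := ii; split.
  move=> /nbhs_ballP[e /= e0 aeP]; have ie0 : 0 < i e by rewrite isometric_gt0.
  have [d di] : exists d, i e = d%:C%C.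
    by exists (complex.Re (i e)); rewrite RRe_real// gtr0_real.
  have d0 : 0 < d by move: ie0; rewrite di ltcR.
  exists (d / 2) => [|x xa]; first by lra.
  apply: aeP; split=> // a0 j; rewrite ord1 /ball/= distrC -subr_gt0.
  rewrite -(isometric_gt0 _ ii) rmorphB -ni subr_gt0 di cmodE ltcR.
  by have := xa j; rewrite !mxE; lra.
move=> [d d0 aP]; have [e ie] := si d; apply/nbhs_ballP.
have e0 : 0 < e by rewrite -(isometric_gt0 _ ii) ie ltcR.
exists e => //= x [_ ax]; apply: aP => j; rewrite !mxE -lecR -cmodE ni.
have := ax 0 j; rewrite /ball/= distrC -subr_gt0 -(isometric_gt0 _ ii).
by rewrite rmorphB subr_gt0 ie => /ltW.
Qed.

(** On complex coordinate spaces neighbourhoods are described by moduli alone,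
    so that real and complex variables share one theory: [nbhs_box] transfers
    the topology of the variables to it. *)
Definition boxnbhs n (a : 'rV[R[i]]_n) : set_system 'rV[R[i]]_n :=
  [set P | exists2 d : R, 0 < d & forall x, inbox d (x - a) -> P x].

Lemma boxnbhs_singleton n (a : 'rV[R[i]]_n) P : boxnbhs a P -> P a.
Proof.
move=> [d d0]; apply; rewrite subrr; apply: inbox0; exact: ltW.
Qed.

Global Instance boxnbhs_filter n (a : 'rV[R[i]]_n) : ProperFilter (boxnbhs a).
Proof.
split; first by move/boxnbhs_singleton.
split; first by exists 1.
  move=> P Q [d d0 dP] [e e0 eQ]; exists (Num.min d e); first by rewrite lt_min d0.
  by move=> x xa; split; [apply: dP|apply: eQ]; apply: inboxW xa; rewrite ge_min lexx ?orbT.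
by move=> P Q PQ [d d0 dP]; exists d => // x /dP /PQ.
Qed.

Lemma boxnbhs_box n (a : 'rV[R[i]]_n) P : boxnbhs a P ->
  \forall s \near 0^'+, forall k, inbox s k -> P (a + k).
Proof.
move=> [d d0 dP]; near=> s => k ks; apply: dP; rewrite (addrC a) addrK.
by apply: inboxW ks; near: s; apply: nbhs_right_le.
Unshelve. all: by end_near. Qed.

Lemma le_epsilon (x y c : R) :
  (forall e, 0 < e <= 1 -> x <= c * e + y) -> x <= y.
Proof.
move=> h; rewrite leNgt; apply/negP => yx.
have c0 : 0 < 1 + `|c| + (x - y) by have := normr_ge0 c; lra.
set e := (x - y) / (1 + `|c| + (x - y)).
have e0 : 0 < e by rewrite divr_gt0// subr_gt0.
have e1 : e <= 1 by rewrite ler_pdivrMr//; have := normr_ge0 c; lra.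
have := h e; rewrite e0 e1 => /(_ isT).
have ec : e * (1 + `|c| + (x - y)) = x - y by rewrite divfK// gt_eqF.
have := ler_norm c; nra.
Qed.

End Boxes.

(** Polynomial expressions; only the function that an expression defines and
    its formal partial derivatives matter. *)
Inductive pexpr (R : realType) (n : nat) :=
  PConst of R[i] | PVar of 'I_n | PAdd of pexpr R n & pexpr R n
| PMul of pexpr R n & pexpr R n.

Section Polynomials.
Variables (R : realType) (n : nat).
Implicit Types (p q : pexpr R n) (x v : 'rV[R[i]]_n) (j : 'I_n).

Fixpoint peval p x : R[i] := match p with
  | PConst c => c | PVar j => x 0 j
  | PAdd p q => peval p x + peval q x | PMul p q => peval p x * peval q x end.

Fixpoint pderiv j p : pexpr R n := match p with
  | PConst c => PConst n 0 | PVar l => PConst n (l == j)%:R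
  | PAdd p q => PAdd (pderiv j p) (pderiv j q)
  | PMul p q => PAdd (PMul (pderiv j p) q) (PMul p (pderiv j q)) end.

(** Estimates in several variables are reduced to one variable by restriction to
    complex lines. *)
Fixpoint pline p x v : {poly R[i]} := match p with
  | PConst c => c%:P | PVar j => (x 0 j)%:P + (v 0 j)%:P * 'X
  | PAdd p q => pline p x v + pline q x v
  | PMul p q => pline p x v * pline q x v end.

Definition pgrad p x : 'rV[R[i]]_n := \row_j peval (pderiv j p) x.

Definition psub p q := PAdd p (PMul (PConst n (-1)) q).

Lemma peval_sub p q x : peval (psub p q) x = peval p x - peval q x.
Proof. by rewrite /= mulN1r. Qed.

Lemma pgrad_sub p q x : pgrad (psub p q) x = pgrad p x - pgrad q x.
Proof. by apply/rowP => j; rewrite !mxE /= mul0r add0r mulN1r. Qed.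

Lemma pderivC j l p x :
  peval (pderiv j (pderiv l p)) x = peval (pderiv l (pderiv j p)) x.
Proof. by elim: p => //= [p -> q ->//|p -> q ->]; ring. Qed.

Lemma pline_eval p x v t : (pline p x v).[t] = peval p (x + t *: v).
Proof.
elim: p => [c|j|p IHp q IHq|p IHp q IHq] /=.
- by rewrite hornerC.
- by rewrite hornerD hornerM !hornerC hornerX !mxE mulrC.
- by rewrite hornerD IHp IHq.
- by rewrite hornerM IHp IHq.
Qed.

Lemma pline_deriv p x v t :
  (pline p x v)^`().[t] = dot v (pgrad p (x + t *: v)).
Proof.
elim: p => [c|j|p IHp q IHq|p IHp q IHq] /=.
- by rewrite derivC horner0 /dot big1// => j _; rewrite mxE mulr0.
- rewrite derivD derivM !derivC derivX mul0r mulr1 !add0r hornerC.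
  rewrite /dot (bigD1 j)//= big1 ?addr0; first by rewrite mxE /= eqxx mulr1.
  by move=> l lj; rewrite mxE /= eq_sym (negbTE lj) mulr0.
- rewrite derivD hornerD IHp IHq -big_split; apply: eq_bigr => j _ /=.
  by rewrite !mxE /= mulrDr.
- rewrite derivM hornerD !hornerM IHp IHq !pline_eval mulr_suml mulr_sumr.
  rewrite -big_split; apply: eq_bigr => j _ /=.
  by rewrite !mxE /=; ring.
Qed.

Lemma peval_bounded p (D : R) :
  exists2 B, 0 <= B & forall x, inbox D x -> cmod (peval p x) <= B.
Proof.
elim: p => [c|j|p [B B0 hB] q [C C0 hC]|p [B B0 hB] q [C C0 hC]] /=.
- by exists (cmod c) => //; exact: cmod_ge0.
- by exists `|D| => // x /(_ j) xD; rewrite (le_trans xD)// ler_norm.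
- exists (B + C); first exact: addr_ge0.
  by move=> x xD; rewrite (le_trans (le_normcD _ _))// lerD ?hB ?hC.
- exists (B * C); first exact: mulr_ge0.
  by move=> x xD; rewrite Normc.normcM ler_pM ?cmod_ge0 ?hB ?hC.
Qed.

Section Estimates.
Variables (p : pexpr R n) (x v : 'rV[R[i]]_n) (B d s : R).
Hypothesis s0 : 0 < s.
Hypothesis d0 : 0 < d.
Hypothesis pB : forall y, inbox d (y - x) -> cmod (peval p y) <= B.
Hypothesis vs : inbox s v.

Let on_circle t : cmod t = d / s -> cmod (pline p x v).[t] <= B.
Proof.
move=> td; rewrite pline_eval; apply: pB.
rewrite addrAC subrr add0r; have := inboxZ t vs.
by rewrite td divfK// gt_eqF.
Qed.

Lemma pgrad_bound : cmod (dot v (pgrad p x)) <= B * (s / d).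
Proof.
have := coef_bound 1 (divr_gt0 d0 s0) on_circle; rewrite expr1.
have -> : (pline p x v)`_1 = dot v (pgrad p x).
  by have := pline_deriv p x v 0; rewrite scale0r addr0 => <-;
     rewrite horner_coef0 coef_deriv.
by rewrite -ler_pdivlMr ?divr_gt0// invf_div.
Qed.

Lemma peval_taylor2 : 2 * s <= d ->
  cmod (peval p (x + v) - peval p x - dot v (pgrad p x)) <= 2 * B * (s / d) ^+ 2.
Proof.
move=> sd; have sd' : 2 <= d / s by rewrite ler_pdivlMr.
have := poly_taylor2 sd' on_circle; rewrite invf_div pline_eval scale1r.
have -> : (pline p x v)`_0 = peval p x.
  by rewrite -horner_coef0 pline_eval scale0r addr0.
have -> // : (pline p x v)`_1 = dot v (pgrad p x).
by have := pline_deriv p x v 0; rewrite scale0r addr0 => <-;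
   rewrite horner_coef0 coef_deriv.
Qed.

End Estimates.

Lemma peval_mean_value p x v (eta : R) :
  (forall t, cmod t = 2 -> cmod (dot v (pgrad p (x + t *: v))) <= eta) ->
  cmod (peval p (x + v) - peval p x) <= 2 * eta.
Proof.
move=> h; have := @poly_mean_value _ (pline p x v) eta.
rewrite !pline_eval scale1r scale0r addr0; apply => t t2.
by rewrite pline_deriv h.
Qed.

End Polynomials.

(** * First order expansions *)

(** First order expansion with a quadratic remainder.  Such expansions compose,
    and they yield both derivatives along curves and their uniqueness. *)
Definition qdiff (R : realType) n (F : 'rV[R[i]]_n -> R[i]) (a d : 'rV[R[i]]_n) :=
  exists M : R, \forall s \near 0^'+, forall k, inbox s k ->
    cmod (F (a + k) - F a - dot k d) <= M * s ^+ 2.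

Definition grad (R : realType) n (F : 'rV[R[i]]_n -> R[i]) (a : 'rV[R[i]]_n) :
  'rV[R[i]]_n := xget 0 [set d | qdiff F a d].

Lemma near_scale (R : realType) (t : R) (P : R -> Prop) : 0 < t ->
  (\forall s \near 0^'+, P s) -> \forall s \near 0^'+, P (s * t).
Proof.
move=> t0 [e /= e0 he]; exists (e / t) => /=; first by rewrite divr_gt0.
move=> s /=; rewrite sub0r normrN => se s0; apply: he => /=; last by rewrite mulr_gt0.
by rewrite sub0r normrN normrM (gtr0_norm t0) -ltr_pdivlMr.
Qed.

Section QuadraticExpansions.
Variable R : realType.
Implicit Types (n : nat).

Lemma qdiff_unique n (F : 'rV[R[i]]_n -> R[i]) a d d' :
  qdiff F a d -> qdiff F a d' -> d = d'.
Proof.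
move=> [M hM] [M' hM']; apply/rowP => j; apply/eqP; rewrite -subr_eq0.
have : cmod (d 0 j - d' 0 j) <= 0.
  apply: (@le_epsilon _ _ _ (`|M| + `|M'|)) => e /andP[e0 e1]; rewrite addr0.
  near (0:R)^'+ => s.
  have s0 : 0 < s by near: s; exact: nbhs_right_gt.
  have se : s <= e by near: s; exact: nbhs_right_le.
  pose k : 'rV[R[i]]_n := s%:C%C *: delta_mx 0 j.
  have ks : inbox s k.
    move=> l; rewrite !mxE eqxx /= Normc.normcM cmod_real gtr0_norm//.
    case: (l == j); rewrite ?mulr1n ?mulr0n.
      by rewrite Normc.normc1 mulr1.
    by rewrite Normc.normc0 mulr0 ltW.
  have h1 : cmod (F (a + k) - F a - dot k d) <= M * s ^+ 2.
    by move: k ks; near: s.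
  have h2 : cmod (F (a + k) - F a - dot k d') <= M' * s ^+ 2.
    by move: k ks {h1}; near: s.
  have : cmod (dot k d - dot k d') <= M * s ^+ 2 + M' * s ^+ 2.
    apply: le_trans (lerD h1 h2); rewrite -[leLHS]normcN.
    apply: le_trans (le_cmodB _ _); rewrite le_eqVlt; apply/orP; left; apply/eqP.
    by congr cmod; ring.
  rewrite !dotZl !dot_delta -mulrBr Normc.normcM cmod_real gtr0_norm//.
  have := ler_norm M; have := ler_norm M'; have := cmod_ge0 (d 0 j - d' 0 j).
  set D := cmod _ => D0 M1 M2 h.
  have : D <= (`|M| + `|M'|) * s by rewrite -(ler_pM2l s0); nra.
  by have := normr_ge0 M; have := normr_ge0 M'; nra.
by move/cmod_le0 => ->.
Unshelve. all: by end_near. Qed.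

Lemma grad_eq n (F : 'rV[R[i]]_n -> R[i]) a d : qdiff F a d -> grad F a = d.
Proof.
move=> Fd; apply: qdiff_unique (Fd).
by have := @xgetI _ 0 [set d | qdiff F a d] d Fd.
Qed.

Lemma qdiff_continuous n (F : 'rV[R[i]]_n -> R[i]) a d : qdiff F a d ->
  exists L : R, \forall s \near 0^'+, forall k, inbox s k ->
    cmod (F (a + k) - F a) <= L * s.
Proof.
move=> [M hM]; have [t t0 dt] := inbox_exists d.
exists (`|M| + n%:R * t); near=> s => k ks.
have s0 : 0 < s by near: s; exact: nbhs_right_gt.
have s1 : s <= 1 by near: s; apply: nbhs_right_le.
have h1 : cmod (F (a + k) - F a - dot k d) <= M * s ^+ 2.
  by move: k ks; near: s.
have h2 := cmod_dot (ltW s0) ks dt.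
have -> : F (a + k) - F a = F (a + k) - F a - dot k d + dot k d by rewrite subrK.
apply: le_trans (le_normcD _ _) _; apply: le_trans (lerD h1 h2) _.
have : M * s ^+ 2 <= `|M| * s.
  apply: (@le_trans _ _ (`|M| * s ^+ 2)).
    by rewrite ler_wpM2r ?sqr_ge0// ler_norm.
  by rewrite ler_wpM2l// expr2 ger_pMr.
by lra.
Unshelve. all: by end_near. Qed.

Lemma qdiff_ext n (F G : 'rV[R[i]]_n -> R[i]) a d :
  (\forall x \near boxnbhs a, F x = G x) -> qdiff F a d -> qdiff G a d.
Proof.
move=> FG [M hM]; have FGs := boxnbhs_box FG; exists M; near=> s => k ks.
rewrite -(boxnbhs_singleton FG).
have <- : F (a + k) = G (a + k) by move: k ks; near: s.
by move: k ks; near: s.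
Unshelve. all: by end_near. Qed.

Lemma qdiff_cst n (c : R[i]) a : qdiff (fun _ : 'rV[R[i]]_n => c) a 0.
Proof.
exists 0; near=> s => k _; rewrite subrr sub0r normcN mul0r.
rewrite /dot big1 ?Normc.normc0// => j _; by rewrite mxE mulr0.
Unshelve. all: by end_near. Qed.

Lemma qdiff_coord n j a : qdiff (fun x : 'rV[R[i]]_n => x 0 j) a (delta_mx 0 j).
Proof.
exists 0; near=> s => k _; rewrite mxE (addrC (a 0 j)) addrK mul0r.
suff -> : dot k (delta_mx 0 j) = k 0 j by rewrite subrr Normc.normc0.
by rewrite -[RHS]dot_delta /dot; apply: eq_bigr => l _; rewrite mulrC.
Unshelve. all: by end_near. Qed.

Lemma uniform_bound (I : finType) (P : I -> R -> R -> Prop) :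
  (forall l M M' s, M <= M' -> P l M s -> P l M' s) ->
  (forall l, exists M, \forall s \near 0^'+, P l M s) ->
  exists2 M, 0 <= M & \forall s \near 0^'+, forall l, P l M s.
Proof.
move=> Pm /choice[M hM]; exists (\sum_l `|M l|); first exact: sumr_ge0.
apply: filter_forall => l; near=> s; apply: (Pm _ (M l)); last by near: s.
rewrite (bigD1 l)//=; apply: le_trans (ler_norm _) _.
by rewrite lerDl sumr_ge0.
Unshelve. all: by end_near. Qed.

Lemma qdiff_comp n p (F : 'rV[R[i]]_n -> R[i]) (M : 'rV[R[i]]_p -> 'rV[R[i]]_n)
    a d (D : 'M[R[i]]_(p, n)) :
  qdiff F (M a) d ->
  (forall j, qdiff (fun x => M x 0 j) a (\row_l D l j)) ->
  qdiff (F \o M) a (\row_l \sum_j D l j * d 0 j).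
Proof.
move=> [A hA] MD.
have [B B0 hB] := uniform_bound (P := fun j B s => forall k, inbox s k ->
    cmod (M (a + k) 0 j - M a 0 j - dot k (\row_l D l j)) <= B * s ^+ 2)
  (fun j B B' s BB' h k ks => le_trans (h k ks) (ler_wpM2r (sqr_ge0 s) BB')) MD.
have ML j : exists L, \forall s \near 0^'+, forall k, inbox s k ->
    cmod (M (a + k) 0 j - M a 0 j) <= L * `|s|.
  have [L hL] := qdiff_continuous (MD j); exists L; near=> s => k ks.
  rewrite gtr0_norm; last by near: s; exact: nbhs_right_gt.
  by move: k ks; near: s.
have [L L0 hL] := uniform_bound (P := fun j L s => forall k, inbox s k ->
    cmod (M (a + k) 0 j - M a 0 j) <= L * `|s|)
  (fun j B B' s BB' h k ks => le_trans (h k ks) (ler_wpM2r (normr_ge0 s) BB')) ML.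
have [t t0 dt] := inbox_exists d.
exists (`|A| * (L + 1) ^+ 2 + n%:R * (B * t)).
have L1 : 0 < L + 1 by lra.
near=> s => k ks.
have s0 : 0 < s by near: s; exact: nbhs_right_gt.
pose u := M (a + k) - M a; have Mu : M (a + k) = M a + u by rewrite [RHS]addrC subrK.
have us : inbox (s * (L + 1)) u.
  move=> j; rewrite !mxE; apply: (@le_trans _ _ (L * `|s|)).
    by move: j k ks {u Mu}; near: s.
  by rewrite gtr0_norm// mulrC ler_pM2l// lerDl.
have h1 : cmod (F (M a + u) - F (M a) - dot u d) <= A * (s * (L + 1)) ^+ 2.
  by move: u us {Mu}; near: s; exact: near_scale hA.
have h2 : cmod (dot u d - dot k (\row_l \sum_j D l j * d 0 j)) <= n%:R * (B * s ^+ 2 * t).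
  pose e : 'rV[R[i]]_n := \row_j (u 0 j - dot k (\row_l D l j)).
  have -> : dot u d - dot k (\row_l \sum_j D l j * d 0 j) = dot e d.
    rewrite /dot; under [X in _ - X]eq_bigr do rewrite mxE mulr_sumr.
    rewrite exchange_big -sumrB; apply: eq_bigr => j _.
    rewrite [e 0 j]mxE mulrBl; congr (_ - _); rewrite /dot mulr_suml.
    by apply: eq_bigr => l _; rewrite !mxE mulrA.
  apply: cmod_dot => //; first by rewrite mulr_ge0// sqr_ge0.
  by move=> j; rewrite !mxE; move: j k ks {u Mu us h1 e}; near: s.
rewrite /= Mu.
have -> : F (M a + u) - F (M a) - dot k (\row_l \sum_j D l j * d 0 j) =
  (F (M a + u) - F (M a) - dot u d) + (dot u d - dot k (\row_l \sum_j D l j * d 0 j)).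
  by rewrite [RHS]addrA subrK.
apply: le_trans (le_normcD _ _) _; apply: le_trans (lerD h1 h2) _.
rewrite (_ : _ * s ^+ 2 = `|A| * (s * (L + 1)) ^+ 2 + n%:R * (B * s ^+ 2 * t)).
  by rewrite lerD2r ler_wpM2r ?sqr_ge0 ?ler_norm.
by ring.
Unshelve. all: by end_near. Qed.

Lemma qdiff_lin n (F G : 'rV[R[i]]_n -> R[i]) a d e (c : R[i]) :
  qdiff F a d -> qdiff G a e -> qdiff (fun x => c * F x + G x) a (c *: d + e).
Proof.
move=> [M hM] [M' hM']; exists (cmod c * M + M'); near=> s => k ks.
have h1 : cmod (F (a + k) - F a - dot k d) <= M * s ^+ 2 by move: k ks; near: s.
have h2 : cmod (G (a + k) - G a - dot k e) <= M' * s ^+ 2.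
  by move: k ks {h1}; near: s.
have -> : dot k (c *: d + e) = c * dot k d + dot k e.
  rewrite /dot mulr_sumr -big_split; apply: eq_bigr => j _ /=.
  by rewrite !mxE; ring.
rewrite (_ : _ - _ - _ = c * (F (a + k) - F a - dot k d) + (G (a + k) - G a - dot k e)).
  apply: le_trans (le_normcD _ _) _; rewrite Normc.normcM mulrDl -mulrA lerD//.
  by rewrite ler_wpM2l ?cmod_ge0.
by ring.
Unshelve. all: by end_near. Qed.

Lemma qdiff_mul n (F G : 'rV[R[i]]_n -> R[i]) a d e :
  qdiff F a d -> qdiff G a e ->
  qdiff (fun x => F x * G x) a (F a *: e + G a *: d).
Proof.
move=> hF hG; have [M hM] := hF; have [M' hM'] := hG.
have [L hL] := qdiff_continuous hF; have [L' hL'] := qdiff_continuous hG.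
exists (cmod (F a) * M' + cmod (G a) * M + L * L'); near=> s => k ks.
have h1 : cmod (F (a + k) - F a - dot k d) <= M * s ^+ 2 by move: k ks; near: s.
have h2 : cmod (G (a + k) - G a - dot k e) <= M' * s ^+ 2.
  by move: k ks {h1}; near: s.
have h3 : cmod (F (a + k) - F a) <= L * s by move: k ks {h1 h2}; near: s.
have h4 : cmod (G (a + k) - G a) <= L' * s by move: k ks {h1 h2 h3}; near: s.
have -> : dot k (F a *: e + G a *: d) = F a * dot k e + G a * dot k d.
  rewrite /dot !mulr_sumr -big_split; apply: eq_bigr => j _ /=.
  by rewrite !mxE; ring.
rewrite (_ : _ - _ - _ = F a * (G (a + k) - G a - dot k e) +
   G a * (F (a + k) - F a - dot k d) + (F (a + k) - F a) * (G (a + k) - G a)).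
  rewrite (_ : (_ + _ + _) * s ^+ 2 = cmod (F a) * (M' * s ^+ 2) +
     cmod (G a) * (M * s ^+ 2) + (L * s) * (L' * s)); last by ring.
  apply: le_trans (le_normcD _ _) _; rewrite lerD//.
    apply: le_trans (le_normcD _ _) _; rewrite !Normc.normcM.
    by rewrite lerD// ler_wpM2l ?cmod_ge0.
  by rewrite Normc.normcM ler_pM ?cmod_ge0.
by ring.
Unshelve. all: by end_near. Qed.

End QuadraticExpansions.

(** * Uniform limits of polynomials *)

Definition approx (R : realType) n (F : 'rV[R[i]]_n -> R[i]) a (d e : R)
    (p : pexpr R n) :=
  forall x, inbox d (x - a) -> cmod (F x - peval p x) <= e.

(** Holomorphic functions, as locally uniform limits of polynomials rather than
    sums of power series: products and restrictions need no rearrangement of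
    series, and derivatives are controlled by Cauchy's estimates.  The box does
    not depend on the precision [e]. *)
Definition holo (R : realType) n (F : 'rV[R[i]]_n -> R[i]) a :=
  exists2 d : R, 0 < d & forall e, 0 < e -> exists p, approx F a d e p.

Section Holomorphic.
Variable R : realType.
Implicit Types (n : nat).

Lemma approxW n (F : 'rV[R[i]]_n -> R[i]) a d d' e p :
  d' <= d -> approx F a d e p -> approx F a d' e p.
Proof. by move=> dd Fp x xa; apply: Fp; apply: inboxW xa. Qed.

Lemma holo_near n (F : 'rV[R[i]]_n -> R[i]) a :
  holo F a -> \forall x \near boxnbhs a, holo F x.
Proof.
move=> [d d0 Fd]; exists (d / 2); first by lra.
move=> x xa; exists (d / 2); first by lra.
move=> e /Fd[p Fp]; exists p => y yx; apply: Fp.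
by rewrite -(subrK x y) -addrA; apply: inboxW (inboxD yx xa); lra.
Qed.

Lemma holo_ext n (F G : 'rV[R[i]]_n -> R[i]) a :
  (\forall x \near boxnbhs a, F x = G x) -> holo F a -> holo G a.
Proof.
move=> [d' d'0 FG] [d d0 Fd]; exists (Num.min d d'); first by rewrite lt_min d0.
move=> e /Fd[p Fp]; exists p => x xa; rewrite -FG; first apply: Fp.
  by apply: inboxW xa; rewrite ge_min lexx.
by apply: inboxW xa; rewrite ge_min lexx orbT.
Qed.

Lemma holo_peval n (p : pexpr R n) a : holo (peval p) a.
Proof.
by exists 1 => // e e0; exists p => x _; rewrite subrr Normc.normc0 ltW.
Qed.

Lemma holo_cst n (c : R[i]) a : holo (fun _ : 'rV[R[i]]_n => c) a.
Proof. exact: (holo_peval (PConst n c)). Qed.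

Lemma holo_coord n j a : holo (fun x : 'rV[R[i]]_n => x 0 j) a.
Proof. exact: (holo_peval (PVar R j)). Qed.

Lemma approx_bounded n (F : 'rV[R[i]]_n -> R[i]) a d p : approx F a d 1 p ->
  exists2 B, 0 <= B & forall x, inbox d (x - a) -> cmod (F x) <= B.
Proof.
move=> Fp; have [s s0 sa] := inbox_exists a.
have [B B0 pB] := peval_bounded p (d + s).
exists (1 + B) => [|x xa]; first by lra.
rewrite -(subrK (peval p x) (F x)) (le_trans (le_normcD _ _))// lerD ?Fp//.
by apply: pB; rewrite -(subrK a x); exact: inboxD.
Qed.

Lemma holoD n (F G : 'rV[R[i]]_n -> R[i]) a :
  holo F a -> holo G a -> holo (fun x => F x + G x) a.
Proof.
move=> [d d0 Fd] [d' d'0 Gd]; exists (Num.min d d'); first by rewrite lt_min d0.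
move=> e e0; have e2 : 0 < e / 2 by lra.
have [p Fp] := Fd _ e2; have [q Gq] := Gd _ e2.
exists (PAdd p q) => x xa /=; rewrite opprD addrACA.
apply: le_trans (le_normcD _ _) _.
have h1 : cmod (F x - peval p x) <= e / 2.
  by apply: Fp; apply: inboxW xa; rewrite ge_min lexx.
have h2 : cmod (G x - peval q x) <= e / 2.
  by apply: Gq; apply: inboxW xa; rewrite ge_min lexx orbT.
by lra.
Qed.

Lemma holoM n (F G : 'rV[R[i]]_n -> R[i]) a :
  holo F a -> holo G a -> holo (fun x => F x * G x) a.
Proof.
move=> [d d0 Fd] [d' d'0 Gd]; set D := Num.min d d'.
have D0 : 0 < D by rewrite lt_min d0.
have Dd : D <= d by rewrite ge_min lexx.
have Dd' : D <= d' by rewrite ge_min lexx orbT.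
have [p1 /(approxW Dd) /approx_bounded[B B0 FB]] := Fd 1 ltac:(by []).
have [q1 /(approxW Dd') /approx_bounded[B' B'0 GB]] := Gd 1 ltac:(by []).
exists D => // e e0.
set e' := Num.min 1 (e / (B + B' + 1)).
have BB : 0 < B + B' + 1 by lra.
have e'0 : 0 < e' by rewrite lt_min ltr01 divr_gt0.
have e'1 : e' <= 1 by rewrite ge_min lexx.
have e'e : e' * (B + B' + 1) <= e by rewrite -ler_pdivlMr// ge_min lexx orbT.
have [p /(approxW Dd) Fp] := Fd _ e'0; have [q /(approxW Dd') Gq] := Gd _ e'0.
exists (PMul p q) => x xa /=.
rewrite (_ : _ - _ = F x * (G x - peval q x) + (F x - peval p x) * peval q x); last by ring.
apply: le_trans (le_normcD _ _) _; rewrite !Normc.normcM.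
have h1 := Fp _ xa; have h2 := Gq _ xa; have h3 := FB _ xa; have h4 := GB _ xa.
have h5 : cmod (peval q x) <= B' + 1.
  have -> : peval q x = G x - (G x - peval q x) by rewrite subKr.
  by apply: le_trans (le_cmodB _ _) _; lra.
have := ler_pM (cmod_ge0 _) (cmod_ge0 _) h3 h2.
have := ler_pM (cmod_ge0 _) (cmod_ge0 _) h1 h5.
by lra.
Qed.

Lemma holo_sum n (I : Type) (r : seq I) (F : I -> 'rV[R[i]]_n -> R[i]) a :
  (forall l, holo (F l) a) -> holo (fun x => \sum_(l <- r) F l x) a.
Proof.
move=> Fa; elim: r => [|l r IH].
  by apply: holo_ext (holo_cst 0 a); near=> x; rewrite big_nil.
by apply: holo_ext (holoD (Fa l) IH); near=> x; rewrite big_cons.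
Unshelve. all: by end_near. Qed.

Fixpoint psubst n m (s : 'I_n -> pexpr R m) (p : pexpr R n) : pexpr R m :=
  match p with
  | PConst c => PConst m c | PVar j => s j
  | PAdd p q => PAdd (psubst s p) (psubst s q)
  | PMul p q => PMul (psubst s p) (psubst s q) end.

Lemma peval_subst n m (s : 'I_n -> pexpr R m) p x :
  peval (psubst s p) x = peval p (\row_j peval (s j) x).
Proof. by elim: p => //= [j|p -> q ->|p -> q ->] //; rewrite mxE. Qed.

Lemma holo_slicel n m (F : 'rV[R[i]]_(n + m) -> R[i]) a b :
  holo F (row_mx a b) -> holo (fun x : 'rV[R[i]]_n => F (row_mx x b)) a.
Proof.
move=> [d d0 Fd]; exists d => // e /Fd[p Fp].
pose s (j : 'I_(n + m)) := match fintype.split j with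
  | inl j => PVar R j | inr k => PConst n (b 0 k) end.
exists (psubst s p) => x xa; rewrite peval_subst.
have -> : \row_j peval (s j) x = row_mx x b.
  by apply/rowP => j; rewrite !mxE /s; case: fintype.splitP.
apply: Fp; rewrite opp_row_mx add_row_mx subrr => j; rewrite mxE.
by case: fintype.splitP => k _; [exact: xa|rewrite mxE Normc.normc0 ltW].
Qed.

Lemma holo_slicer n m (F : 'rV[R[i]]_(n + m) -> R[i]) a b :
  holo F (row_mx a b) -> holo (fun y : 'rV[R[i]]_m => F (row_mx a y)) b.
Proof.
move=> [d d0 Fd]; exists d => // e /Fd[p Fp].
pose s (j : 'I_(n + m)) := match fintype.split j with
  | inl k => PConst m (a 0 k) | inr j => PVar R j end.
exists (psubst s p) => x xa; rewrite peval_subst.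
have -> : \row_j peval (s j) x = row_mx a x.
  by apply/rowP => j; rewrite !mxE /s; case: fintype.splitP.
apply: Fp; rewrite opp_row_mx add_row_mx subrr => j; rewrite mxE.
by case: fintype.splitP => k _; [rewrite mxE Normc.normc0 ltW|exact: xa].
Qed.

Section Gradient.
Variables (n : nat) (F : 'rV[R[i]]_n -> R[i]) (a : 'rV[R[i]]_n) (d : R).
Hypothesis d0 : 0 < d.
Hypothesis Fd : forall e, 0 < e -> exists p, approx F a d e p.

Let half y x : inbox (d / 2) (x - a) -> inbox (d / 2) (y - x) -> inbox d (y - a).
Proof.
move=> xa yx; rewrite -(subrK x y) -addrA.
by apply: inboxW (inboxD yx xa); lra.
Qed.

Lemma pgrad_close p q (e e' : R) x j : inbox (d / 2) (x - a) ->
  approx F a d e p -> approx F a d e' q ->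
  cmod (peval (pderiv j p) x - peval (pderiv j q) x) <= (e + e') * (2 / d).
Proof.
move=> xa Fp Fq; have d2 : 0 < d / 2 by rewrite divr_gt0.
have h : inbox 1 (delta_mx 0 j : 'rV[R[i]]_n).
  move=> l; rewrite mxE eqxx /=; case: (l == j).
    by rewrite mulr1n Normc.normc1.
  by rewrite mulr0n Normc.normc0.
have := @pgrad_bound _ _ (psub p q) x (delta_mx 0 j) (e + e') _ 1 ltr01 d2 _ h.
rewrite dot_delta pgrad_sub !mxE mul1r invf_div; apply=> y yx.
have ya := half xa yx; rewrite peval_sub.
rewrite (_ : _ - _ = (F y - peval q y) - (F y - peval p y)); last by ring.
by apply: le_trans (le_cmodB _ _) _; rewrite addrC lerD ?Fp ?Fq.
Qed.

(** The gradients of approximating polynomials converge uniformly, by Cauchy's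
    estimates; their limit is the gradient. *)
Lemma grad_limit x : inbox (d / 2) (x - a) ->
  exists g : 'rV[R[i]]_n, forall e p, 0 < e -> approx F a d e p ->
    forall j, cmod (g 0 j - peval (pderiv j p) x) <= e * (2 / d).
Proof.
move=> xa; have eN N : 0 < (N.+1%:R)^-1 :> R by rewrite invr_gt0 ltr0n.
have [p hp] := choice (fun N => Fd (eN N)).
have lim j : exists l, forall N,
    cmod (l - peval (pderiv j (p N)) x) <= 2 * (2 * N.+1%:R^-1 * (2 / d)).
  apply: complex_limit_rate => N M NM.
  apply: le_trans (pgrad_close j xa (hp M) (hp N)) _.
  rewrite ler_pM2r ?divr_gt0// mulr_natl mulr2n lerD2r lef_pV2 ?posrE ?ltr0n//.
  by rewrite ler_nat.
have [g hg] := choice lim; exists (\row_j g j) => e q e0 Fq j; rewrite mxE.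
apply: (@le_epsilon _ _ _ (5 * (2 / d))) => eta /andP[eta0 eta1].
pose N := Num.trunc eta^-1.
have Ne : N.+1%:R^-1 <= eta.
  rewrite -[leRHS]invrK lef_pV2 ?posrE ?ltr0n ?invr_gt0// ltW//.
  by rewrite truncnS_gt.
have h1 := hg j N; have h2 := pgrad_close j xa (hp N) Fq.
rewrite -(subrK (peval (pderiv j (p N)) x) (g j)) -addrA.
apply: le_trans (le_normcD _ _) _; apply: le_trans (lerD h1 h2) _.
have dd : 0 < 2 / d by rewrite divr_gt0.
have := ler_wpM2r (ltW dd) Ne; set u := 2 / d; set v := N.+1%:R^-1.
by lra.
Qed.

Lemma approx_gradP x : inbox (d / 2) (x - a) ->
  qdiff F x (grad F x) /\
  forall e p, 0 < e -> approx F a d e p ->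
    forall j, cmod (grad F x 0 j - peval (pderiv j p) x) <= e * (2 / d).
Proof.
move=> xa; have d_gt0 := d0; have [g hg] := grad_limit xa.
have [p1 /approx_bounded[B B0 FB]] := Fd ltr01.
suff Fg : qdiff F x g by rewrite (grad_eq Fg).
exists (2 * (B + 1) * (2 / d) ^+ 2); near=> s => k ks.
have s0 : 0 < s by near: s; exact: nbhs_right_gt.
have sd : s <= d / 4 by near: s; apply: nbhs_right_le; lra.
have d2 : 0 < d / 2 by lra.
apply: (@le_epsilon _ _ _ (2 + n%:R * (s * (2 / d)))) => e /andP[e0 e1].
have [p Fp] := Fd e0.
have pB y : inbox (d / 2) (y - x) -> cmod (peval p y) <= B + 1.
  move=> yx; have ya := half xa yx.
  rewrite (_ : peval p y = F y - (F y - peval p y)); last by rewrite subKr.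
  apply: le_trans (le_cmodB _ _) _.
  by rewrite lerD ?FB// (le_trans (Fp _ ya)).
have ska : inbox (d / 2) (x + k - x).
  by rewrite (addrC x) addrK; apply: inboxW ks; lra.
have h0 := @peval_taylor2 _ _ p x k (B + 1) _ s s0 pB ks ltac:(lra).
have h1 := Fp _ (half xa ska).
have h2 : cmod (F x - peval p x) <= e.
  by apply: Fp; apply: inboxW xa; lra.
have h3 : cmod (dot k (g - pgrad p x)) <= n%:R * (s * (e * (2 / d))).
  by apply: cmod_dot; [exact: ltW|by []|move=> j; rewrite !mxE hg].
rewrite (_ : _ - _ - _ = (F (x + k) - peval p (x + k)) - (F x - peval p x)
  - dot k (g - pgrad p x) + (peval p (x + k) - peval p x - dot k (pgrad p x)));
  last by rewrite -dotBr; ring.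
apply: le_trans (le_normcD _ _) _.
apply: (@le_trans _ _ ((e + e + n%:R * (s * (e * (2 / d)))) + 2 * (B + 1) * (s / (d / 2)) ^+ 2)).
  apply: lerD => //; apply: le_trans (le_cmodB _ _) _; apply: lerD => //.
  by apply: le_trans (le_cmodB _ _) _; exact: lerD.
rewrite invf_div le_eqVlt; apply/orP; left; apply/eqP.
by ring.
Unshelve. all: by end_near. Qed.

Lemma approx_grad p (e : R) j : 0 < e -> approx F a d e p ->
  approx (fun x => grad F x 0 j) a (d / 2) (e * (2 / d)) (pderiv j p).
Proof. by move=> e0 Fp x xa; have [_] := approx_gradP xa; apply. Qed.

End Gradient.

Lemma holo_qdiff n (F : 'rV[R[i]]_n -> R[i]) a :
  holo F a -> qdiff F a (grad F a).
Proof.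
move=> [d d0 Fd]; have a0 : inbox (d / 2) (a - a) by rewrite subrr; apply: inbox0; lra.
by have [] := approx_gradP d0 Fd a0.
Qed.

Lemma holo_grad n (F : 'rV[R[i]]_n -> R[i]) a j :
  holo F a -> holo (fun x => grad F x 0 j) a.
Proof.
move=> [d d0 Fd]; exists (d / 2) => [|e e0]; first by lra.
have e'0 : 0 < e / (2 / d) by rewrite !divr_gt0.
have [p Fp] := Fd _ e'0; exists (pderiv j p).
have := approx_grad d0 Fd j e'0 Fp.
by rewrite divfK// gt_eqF// divr_gt0.
Qed.

(** Symmetry of second derivatives passes to the limit. *)
Lemma gradC n (F : 'rV[R[i]]_n -> R[i]) a j k : holo F a ->
  grad (fun x => grad F x 0 j) a 0 k = grad (fun x => grad F x 0 k) a 0 j.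
Proof.
move=> [d d0 Fd]; have d20 : 0 < d / 2 by lra.
have Gd l e : 0 < e -> exists p, approx (fun x => grad F x 0 l) a (d / 2) e p.
  move=> e0; have e'0 : 0 < e / (2 / d) by rewrite !divr_gt0.
  have [p Fp] := Fd _ e'0; exists (pderiv l p).
  have := approx_grad d0 Fd l e'0 Fp.
  by rewrite divfK// gt_eqF// divr_gt0.
apply/eqP; rewrite -subr_eq0; set D := _ - _.
have : cmod D <= 0; last first.
  by move/cmod_le0 => ->.
apply: (@le_epsilon _ _ _ (2 * ((2 / d) * (2 / (d / 2))))) => e /andP[e0 _].
have [p Fp] := Fd _ e0; have e'0 : 0 < e * (2 / d) by rewrite mulr_gt0// divr_gt0.
have a0 : inbox (d / 2 / 2) (a - a) by rewrite subrr; apply: inbox0; lra.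
have h1 := approx_grad d20 (Gd j) k e'0 (approx_grad d0 Fd j e0 Fp) a0.
have h2 := approx_grad d20 (Gd k) j e'0 (approx_grad d0 Fd k e0 Fp) a0.
rewrite pderivC in h2.
rewrite (_ : D = (grad (fun x => grad F x 0 j) a 0 k - peval (pderiv k (pderiv j p)) a)
  - (grad (fun x => grad F x 0 k) a 0 j - peval (pderiv k (pderiv j p)) a)).
  by apply: le_trans (le_cmodB _ _) _; lra.
by rewrite /D; ring.
Qed.

(** The inequality for polynomials passes to the limit; the gradient has to be
    bounded on the doubled box because the polynomial inequality uses the circle
    of radius 2. *)
Lemma mean_value n (F : 'rV[R[i]]_n -> R[i]) a : holo F a ->
  exists2 d : R, 0 < d & forall x r eta, 0 < r <= d -> inbox r (x - a) ->
    (forall y, inbox (2 * r) (y - a) -> inbox eta (grad F y)) ->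
    cmod (F x - F a) <= 2 * (n%:R * (r * eta)).
Proof.
move=> [d d0 Fd]; exists (d / 4) => [|x r eta /andP[r0 rd] xr Feta]; first by lra.
apply: (@le_epsilon _ _ _ (2 * (n%:R * (r * (2 / d))) + 2)) => e /andP[e0 _].
have [p Fp] := Fd _ e0.
have hx : cmod (F x - peval p x) <= e by apply: Fp; apply: inboxW xr; lra.
have ha : cmod (F a - peval p a) <= e.
  by apply: Fp; rewrite subrr; apply: inbox0; exact: ltW.
have hp : cmod (peval p (a + (x - a)) - peval p a) <=
    2 * (n%:R * (r * (eta + e * (2 / d)))).
  apply: peval_mean_value => t t2; apply: cmod_dot => //; first exact: ltW.
  move=> j; have y2 : inbox (2 * r) (a + t *: (x - a) - a).
    by rewrite (addrC a) addrK -t2; exact: inboxZ.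
  have y2' : inbox (d / 2) (a + t *: (x - a) - a) by apply: inboxW y2; lra.
  have h1 := Feta _ y2 j; have h2 := approx_grad d0 Fd j e0 Fp y2'.
  rewrite mxE; move: h1 h2; set g := grad F _ 0 j; set q := peval _ _ => h1 h2.
  by rewrite -(subKr g q); apply: le_trans (le_cmodB _ _) _; exact: lerD.
have xE : a + (x - a) = x by rewrite addrC subrK.
rewrite xE in hp.
rewrite (_ : _ - _ = (F x - peval p x) - (F a - peval p a) + (peval p x - peval p a)); last by ring.
apply: le_trans (le_normcD _ _) _.
have := le_cmodB (F x - peval p x) (F a - peval p a).
move: hp; set A := n%:R * (r * (eta + _)); set B := n%:R * (r * (2 / d)).
have -> : A = n%:R * (r * eta) + e * B by rewrite /A /B; ring.
by lra.
Qed.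

(** A function of one variable that vanishes to infinite order at 0 and is a
    uniform limit of polynomials on the disc of radius 2 vanishes at 1: the low
    coefficients of the approximating polynomials are small because of the
    behaviour near 0, the high ones by Cauchy's estimates. *)
Lemma flat_zero1 (f : R[i] -> R[i]) :
  (forall e : R, 0 < e -> exists p : {poly R[i]},
     forall t, cmod t <= 2 -> cmod (f t - p.[t]) <= e) ->
  (forall m, exists M : R, \forall s \near 0^'+, forall t, cmod t <= s ->
     cmod (f t) <= M * s ^+ m) ->
  f 1 = 0.
Proof.
move=> fp f0.
have [B B0 fB] : exists2 B : R, 0 <= B & forall t, cmod t <= 2 -> cmod (f t) <= B.
  have [p hp] := fp 1 ltac:(by []).
  exists (1 + \sum_(k < size p) cmod p`_k * 2 ^+ k).
    rewrite addr_ge0// sumr_ge0// => k _.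
    by rewrite mulr_ge0 ?cmod_ge0// exprn_ge0.
  move=> t t2; rewrite -(subrK p.[t] (f t)) (le_trans (le_normcD _ _))//.
  rewrite lerD ?hp// horner_coef; apply: le_trans (cmod_sum _ _ _) _.
  apply: ler_sum => k _; rewrite Normc.normcM cmodX ler_wpM2l ?cmod_ge0//.
  by rewrite lerXn2r ?nnegrE ?cmod_ge0.
have : cmod (f 1) <= 0; last first.
  exact: cmod_le0.
apply: (@le_epsilon _ _ _ 4) => eta /andP[eta0 eta1].
(* The coefficients from [m] on are negligible; on the circle of radius [s]
   flatness to order m + 1 makes the others small, up to the error [e] divided by
   s ^ m, so that [e] is chosen after [s]. *)
have [m hm] : exists m, 2 * (B + 1) * 2^-1 ^+ m <= eta.
  pose m := Num.trunc (2 * (B + 1) / eta); exists m.+1.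
  rewrite exprVn ler_pdivrMr ?exprn_gt0// [leRHS]mulrC -ler_pdivrMr//.
  apply: (@le_trans _ _ m.+1%:R); first by rewrite /m; exact: ltW (truncnS_gt _).
  by rewrite -natrX ler_nat ltnW// ltn_expl.
have [M hM] := f0 m.+1.
near (0:R)^'+ => s.
have s0 : 0 < s by near: s; exact: nbhs_right_gt.
have s1 : s <= 1 by near: s; apply: nbhs_right_le.
have sM : m%:R * (`|M| * s) <= eta.
  rewrite mulrA mulrC; apply: (@le_trans _ _ (s * (m%:R * `|M| + 1))).
    by rewrite ler_pM2l// lerDl.
  have c0 : 0 < m%:R * `|M| + 1 by rewrite ltr_wpDl// mulr_ge0.
  by rewrite -ler_pdivlMr//; near: s; apply: nbhs_right_le; rewrite divr_gt0.
have fs t : cmod t <= s -> cmod (f t) <= `|M| * s ^+ m.+1.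
  move=> ts; apply: (@le_trans _ _ (M * s ^+ m.+1)); first by move: t ts; near: s.
  by rewrite ler_wpM2r ?ler_norm// exprn_ge0// ltW.
pose e := Num.min 1 (eta * s ^+ m / (m.+1)%:R).
have sm0 : 0 < s ^+ m by rewrite exprn_gt0.
have e0 : 0 < e by rewrite lt_min ltr01 divr_gt0 ?mulr_gt0 ?ltr0n.
have e1 : e <= 1 by rewrite ge_min lexx.
have em : m.+1%:R * (e / s ^+ m) <= eta.
  by rewrite mulrA ler_pdivrMr// mulrC -ler_pdivlMr ?ltr0n// ge_min lexx orbT.
have e_eta : e <= eta.
  apply: le_trans em; rewrite -[leLHS]mul1r ler_pM ?ler1n// ?(ltW e0)//.
  by rewrite ler_peMr ?(ltW e0)// invf_ge1// exprn_ile1// ltW.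
have [p hp] := fp _ e0.
have pB t : cmod t = 2 -> cmod p.[t] <= B + 1.
  move=> t2; have t2' : cmod t <= 2 by rewrite t2.
  rewrite -(subKr (f t) p.[t]); apply: le_trans (le_cmodB _ _) _.
  by rewrite lerD ?fB// (le_trans (hp _ t2')).
have ps t : cmod t = s -> cmod p.[t] <= e + `|M| * s ^+ m.+1.
  move=> ts; have t2 : cmod t <= 2 by rewrite ts; lra.
  rewrite -(subKr (f t) p.[t]); apply: le_trans (le_cmodB _ _) _.
  by rewrite addrC lerD ?hp// fs ?ts.
have tail := poly_tail m (lexx 2) pB.
have low : cmod (\sum_(k < m) p`_k) <= m%:R * (e / s ^+ m) + m%:R * (`|M| * s).
  rewrite -mulrDr (_ : m%:R * _ = \sum_(k < m) (e / s ^+ m + `|M| * s)); last first.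
    by rewrite sumr_const card_ord mulr_natl.
  apply: le_trans (cmod_sum _ _ _) _; apply: ler_sum => k _.
  have := coef_bound k s0 ps; rewrite -ler_pdivlMr ?exprn_gt0//.
  move/le_trans; apply; rewrite ler_pdivrMr ?exprn_gt0// mulrDl lerD//.
    rewrite -mulrA -ler_pdivrMl// mulVf ?gt_eqF// mulrC.
    rewrite ler_pdivlMr// mul1r; apply: (ler_wiXn2l (ltW s0) s1).
    exact: ltnW.
  rewrite -mulrA -exprS ler_wpM2l//; apply: (ler_wiXn2l (ltW s0) s1).
  by rewrite ltnS ltnW.
have h1 : cmod (f 1 - p.[1]) <= e by apply: hp; rewrite Normc.normc1; lra.
rewrite (_ : f 1 = (f 1 - p.[1]) + (p.[1] - \sum_(k < m) p`_k) + \sum_(k < m) p`_k); last by ring.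
apply: le_trans (le_normcD _ _) _.
have := le_normcD (f 1 - p.[1]) (p.[1] - \sum_(k < m) p`_k).
have : m%:R * (e / s ^+ m) <= eta.
  apply: le_trans em; rewrite ler_pM2r ?divr_gt0// ler_nat//.
by lra.
Unshelve. all: by end_near. Qed.

Lemma flat_zero n (F : 'rV[R[i]]_n -> R[i]) a : holo F a ->
  (forall m, exists M : R, \forall s \near 0^'+, forall k, inbox s k ->
     cmod (F (a + k)) <= M * s ^+ m) ->
  \forall x \near boxnbhs a, F x = 0.
Proof.
move=> [d d0 Fd] F0; exists (d / 2) => [|x xa]; first by lra.
have -> : F x = F (a + 1 *: (x - a)) by rewrite scale1r addrC subrK.
apply: (@flat_zero1 (fun t => F (a + t *: (x - a)))).
  move=> e /Fd[p Fp]; exists (pline p a (x - a)) => t t2.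
  rewrite pline_eval; apply: Fp; rewrite (addrC a) addrK.
  apply: inboxW (inboxZ t xa); have := cmod_ge0 t; nra.
move=> m; have [M hM] := F0 m; exists (M * (d / 2) ^+ m).
have d20 : 0 < d / 2 by lra.
have := near_scale d20 hM; apply: filterS => s hs t ts.
rewrite -mulrA -exprMn mulrC (mulrC (d / 2)) mulrC; apply: hs.
by apply: inboxW (inboxZ t xa); rewrite ler_wpM2r// ltW.
Qed.

End Holomorphic.

(** * Power series *)

Section BoxSums.

(** Boxes of different sizes are compared within one index type. *)
Lemma box_sum_widen (L : numFieldType) n (u : {ffun 'I_n -> nat} -> L) N M :
  (N <= M)%N -> box_sum u N =
  \sum_(al : {ffun 'I_n -> 'I_M} | [forall j, (al j < N)%N])
     u [ffun j => nat_of_ord (al j)].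
Proof.
move=> NM; pose h (al : {ffun 'I_n -> 'I_N}) : {ffun 'I_n -> 'I_M} :=
  [ffun j => widen_ord NM (al j)].
have hI : injective h.
  move=> al be /ffunP ab; apply/ffunP => j; apply/val_inj.
  by have := ab j; rewrite !ffunE => /(congr1 val).
transitivity (\sum_(al in [set h x | x in [set: {ffun 'I_n -> 'I_N}]]%SET)
   u [ffun j => nat_of_ord (al j)]).
  rewrite big_imset/=; last by move=> al be _ _; exact: hI.
  apply: eq_big => [al|al _]; first by rewrite finset.in_setT.
  by congr u; apply/ffunP => j; rewrite !ffunE.
apply: eq_bigl => al; apply/imsetP/forallP => [[be _ ->] j|alN].
  by rewrite ffunE /=.
exists [ffun j => Ordinal (alN j)] => //; apply/ffunP => j.
by apply/val_inj; rewrite !ffunE.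
Qed.

Variable R : realType.

Lemma box_sumR n (w : {ffun 'I_n -> nat} -> R) N :
  box_sum (L := R[i]) (fun al => (w al)%:C%C) N = (box_sum w N)%:C%C.
Proof. by rewrite /box_sum rmorph_sum. Qed.

Lemma box_sum_diff n (u : {ffun 'I_n -> nat} -> R[i])
    (w : {ffun 'I_n -> nat} -> R) N M : (N <= M)%N ->
  (forall al, cmod (u al) <= w al) ->
  cmod (box_sum (L := R[i]) u M - box_sum (L := R[i]) u N) <=
    box_sum w M - box_sum w N.
Proof.
move=> NM uw; rewrite !(box_sum_widen _ NM) /box_sum.
rewrite (bigID (fun al : {ffun 'I_n -> 'I_M} => [forall j, (al j < N)%N]))/=.
rewrite [in leRHS](bigID (fun al : {ffun 'I_n -> 'I_M} => [forall j, (al j < N)%N]))/=.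
rewrite addrAC subrr add0r addrAC subrr add0r.
by apply: le_trans (cmod_sum _ _ _) _; apply: ler_sum => al _; exact: uw.
Qed.

Definition is_peval n (f : 'rV[R[i]]_n -> R[i]) := exists p, forall z, peval p z = f z.

Lemma is_peval_sum n (I : Type) (r : seq I) (f : I -> 'rV[R[i]]_n -> R[i]) :
  (forall l, is_peval (f l)) -> is_peval (fun z => \sum_(l <- r) f l z).
Proof.
move=> fp; elim: r => [|l r [p hp]].
  by exists (PConst n 0) => z; rewrite big_nil.
by have [q hq] := fp l; exists (PAdd q p) => z; rewrite big_cons /= hp hq.
Qed.

Lemma is_peval_prod n (I : Type) (r : seq I) (f : I -> 'rV[R[i]]_n -> R[i]) :
  (forall l, is_peval (f l)) -> is_peval (fun z => \prod_(l <- r) f l z).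
Proof.
move=> fp; elim: r => [|l r [p hp]].
  by exists (PConst n 1) => z; rewrite big_nil.
by have [q hq] := fp l; exists (PMul q p) => z; rewrite big_cons /= hp hq.
Qed.

Lemma is_peval_box n (c : {ffun 'I_n -> nat} -> R[i]) a N :
  is_peval (fun z => box_sum (L := R[i])
     (fun al => c al * monomial (K := R[i]) (L := R[i]) idfun al (z - a)) N).
Proof.
apply: is_peval_sum => al; rewrite /monomial.
have [p hp] : is_peval (fun z : 'rV[R[i]]_n => \prod_(j < n)
    (z - a) 0 j ^+ ([ffun j0 => nat_of_ord (al j0)] j)).
  apply: is_peval_prod => j; move: (_ j) => e.
  elim: e => [|e [p hp]]; first by exists (PConst n 1) => z; rewrite expr0.
  exists (PMul (PAdd (PVar R j) (PConst n (- a 0 j))) p) => z.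
  by rewrite exprS -hp /= !mxE.
by exists (PMul (PConst n (c [ffun j => nat_of_ord (al j)])) p) => z; rewrite /= hp.
Qed.

End BoxSums.

Section Extension.
Variable R : realType.

Lemma cvg_complexP (u : nat -> (R[i] : numFieldType)) (l : R[i]) :
  (u @ \oo --> (l : (R[i] : numFieldType))) <->
  forall e : R, 0 < e -> \forall N \near \oo, cmod (l - u N) <= e.
Proof.
split=> [/cvgrPdist_le h e e0|h].
  have e0' : 0 < e%:C%C by rewrite ltcR.
  by near do rewrite -lecR; apply: h.
apply/cvgrPdist_le => e e0.
have eE : (complex.Re e)%:C%C = e by rewrite RRe_real// gtr0_real.
have e0' : 0 < complex.Re e by rewrite -ltcR eE.
by have := h _ e0'; apply: filterS => N; rewrite -lecR eE.
Unshelve. all: by end_near. Qed.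

Variables (K : numFieldType) (i : {rmorphism K -> R[i]}).
Hypothesis ii : isometric i.

(** A convergent power series in real or complex variables converges on a
    complex polydisc, and uniformly so: the box sums are polynomials, and their
    differences are dominated by those of the series of absolute values at one
    point with all coordinates equal to the radius. *)
Lemma analytic_holo n (F : 'rV[K]_n -> R[i]) (a : 'rV[K]_n) :
  analytic_at (L := R[i]) i F a ->
  exists2 Phi : 'rV[R[i]]_n -> R[i], holo Phi (map_mx i a) &
    \forall x \near a, F x = Phi (map_mx i x).
Proof.
move=> [c /(nbhs_box _ _ ii)[d d0 Fd]].
(* The series of absolute values is evaluated at the corner a + (e, ..., e), where
   its terms are the [w al]; its partial sums are [W] and its sum is [L]. *)
have [e ie] := ii.2 d.
pose dm (al : {ffun 'I_n -> nat}) : R := \prod_(j < n) d ^+ al j.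
pose w al := cmod (c al) * dm al; pose W := box_sum w.
have dm0 al : 0 <= dm al.
  by apply: prodr_ge0 => j _; rewrite exprn_ge0// ltW.
have mon z al : inbox d z ->
    cmod (c al * monomial (K := R[i]) (L := R[i]) idfun al z) <= w al.
  move=> zd; rewrite Normc.normcM ler_wpM2l ?cmod_ge0// /monomial /dm.
  elim/big_ind2: _ => [|x y x' y' xy xy'|j _]; first by rewrite Normc.normc1.
    by rewrite Normc.normcM ler_pM ?cmod_ge0.
  by rewrite cmodX; apply: lerXn2r; rewrite ?nnegrE ?cmod_ge0 ?(ltW d0)//; exact: zd.
have wE al : `|c al * monomial (L := R[i]) i al (a + const_mx e - a)| = (w al)%:C%C.
  rewrite cmodE Normc.normcM; congr ((_ * _)%:C%C); rewrite /monomial.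
  rewrite (_ : \prod_(j < n) _ = (dm al)%:C%C).
    by rewrite cmod_real ger0_norm.
  rewrite /dm rmorph_prod; apply: eq_bigr => j _.
  by rewrite !mxE (addrC (a 0 j)) addrK ie rmorphXn.
have [l ul] : exists l : R[i], (fun N => (W N)%:C%C : (R[i] : numFieldType)) @ \oo --> (l : (R[i] : numFieldType)).
  have [|+ _] := Fd (a + const_mx e).
    move=> j; rewrite !mxE (addrC (a 0 j)) addrK ie cmod_real.
    by rewrite gtr0_norm.
  move=> /cvg_ex[l hl]; exists l; move: hl; apply: cvg_trans.
  by apply: near_eq_cvg; near=> N; rewrite -box_sumR; apply: eq_bigr => al _; rewrite wE.
move/cvg_complexP: ul => ul.
have Wmono N M : (N <= M)%N -> W N <= W M.
  move=> NM; rewrite -subr_ge0; apply: le_trans (cmod_ge0 _) (box_sum_diff NM (u := fun=> 0) _).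
  by move=> al; rewrite Normc.normc0 mulr_ge0// cmod_ge0.
pose L := complex.Re l.
have LW e' : 0 < e' -> \forall N \near \oo, `|L - W N| <= e'.
  move=> /ul; apply: filterS => N; apply: le_trans.
  by apply: le_trans (cmod_Re _); rewrite ReB.
have WL N : W N <= L.
  apply: (@le_epsilon _ _ _ 1) => e' /andP[e'0 _]; rewrite mul1r.
  near \oo => M; have NM : (N <= M)%N by near: M; exact: nbhs_infty_ge.
  have := Wmono _ _ NM; have : `|L - W M| <= e' by near: M; exact: LW.
  by rewrite ler_norml; lra.
pose S N z := box_sum (L := R[i])
  (fun al => c al * monomial (K := R[i]) (L := R[i]) idfun al (z - map_mx i a)) N.
have lim z : exists l, inbox d (z - map_mx i a) ->
    forall N, cmod (l - S N z) <= 2 * (L - W N).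
  have [zd|zd] := pselect (inbox d (z - map_mx i a)); last by exists 0.
  have [|l' hl'] := @complex_limit_rate R (fun N => S N z) (fun N => L - W N).
    move=> N M NM; apply: le_trans (box_sum_diff NM (w := w) _) _.
      by move=> al; exact: mon.
    by have := WL M; rewrite -/(W M) -/(W N); lra.
  by exists l' => _.
have [Phi hPhi] := choice lim.
exists Phi.
  exists d => // e' e'0; have e2 : 0 < e' / 2 by lra.
  near \oo => N; have [p hp] := is_peval_box c (map_mx i a) N.
  exists p => x xa; rewrite hp; apply: le_trans (hPhi _ xa N) _.
  have : `|L - W N| <= e' / 2 by near: N; exact: LW.
  by rewrite ler_norml; lra.
apply/(nbhs_box _ _ ii); exists d => // x xa.
have [_ /cvg_complexP Fx] := Fd x xa.
apply/eqP; rewrite -subr_eq0.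
have : cmod (F x - Phi (map_mx i x)) <= 0; last first.
  by move/cmod_le0 => ->.
have xa' : inbox d (map_mx i x - map_mx i a) by rewrite -map_mxB.
apply: (@le_epsilon _ _ _ 3) => e' /andP[e'0 _]; rewrite addr0.
near \oo => N.
have h1 : `|L - W N| <= e' by near: N; exact: LW.
have h2 := hPhi _ xa' N.
have h3 : cmod (F x - S N (map_mx i x)) <= e'.
  have -> : S N (map_mx i x) = box_sum (L := R[i])
      (fun al => c al * monomial (L := R[i]) i al (x - a)) N.
    apply: eq_bigr => al _; congr (_ * _); apply: eq_bigr => j _.
    by rewrite -map_mxB mxE.
  by near: N; exact: Fx.
rewrite (_ : _ - _ = (F x - S N (map_mx i x)) - (Phi (map_mx i x) - S N (map_mx i x))); last by ring.
apply: le_trans (le_cmodB _ _) _.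
by move: h1; rewrite ler_norml; lra.
Unshelve. all: by end_near. Qed.

End Extension.

Section RealAnalytic.
Variable R : realType.

Lemma cvg_real_complex (u : nat -> R) (l : R) : u @ \oo --> l ->
  (fun N => (u N)%:C%C : (R[i] : numFieldType)) @ \oo -->
    (l%:C%C : (R[i] : numFieldType)).
Proof.
move=> /cvgrPdist_le ul; apply/cvg_complexP => e e0.
by near do rewrite -rmorphB cmod_real; apply: ul.
Unshelve. all: by end_near. Qed.

Lemma analytic_real_complex n (F : 'rV[R]_n -> R) (a : 'rV[R]_n) :
  analytic_at idfun F a ->
  analytic_at (L := R[i]) (real_complex R) (fun x => (F x)%:C%C) a.
Proof.
move=> [c ca]; exists (fun al => (c al)%:C%C); near=> x.
have [|h1 h2] := near ca x; first by [].
have mE al : (c al)%:C%C * monomial (L := R[i]) (real_complex R) al (x - a) =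
    (c al * monomial idfun al (x - a))%:C%C.
  rewrite rmorphM; congr (_ * _); rewrite /monomial rmorph_prod.
  by apply: eq_bigr => j _; rewrite rmorphXn.
split.
  have [l hl] := (@cvg_ex _ _).1 h1; apply/cvg_ex; exists (l%:C%C).
  apply: cvg_trans (cvg_real_complex hl); apply: near_eq_cvg; near=> N.
  rewrite -box_sumR; apply: eq_bigr => al _.
  by rewrite mE cmodE cmod_real.
apply: cvg_trans (cvg_real_complex h2); apply: near_eq_cvg; near=> N.
by rewrite -box_sumR; apply: eq_bigr => al _; rewrite mE.
Unshelve. all: by end_near. Qed.

End RealAnalytic.

(** * Expansions along left translations *)

Section Slices.
Variable R : realType.

Lemma qdiff_slice n m (F : 'rV[R[i]]_(n + m) -> R[i]) a b d :
  qdiff F (row_mx a b) d -> qdiff (fun y => F (row_mx a y)) b (rsubmx d).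
Proof.
move=> [M hM]; exists M; near=> s => k ks.
have s0 : 0 < s by near: s; exact: nbhs_right_gt.
have ks' : inbox s (row_mx (0 : 'rV[R[i]]_n) k).
  move=> j; rewrite mxE; case: fintype.splitP => l _; last exact: ks.
  by rewrite mxE Normc.normc0 ltW.
have := near hM s; move/(_ ltac:(by []) _ ks').
rewrite add_row_mx addr0 (_ : dot (row_mx 0 k) d = dot k (rsubmx d))//.
rewrite /dot big_split_ord /= big1 ?add0r => [|j _].
  by apply: eq_bigr => j _; rewrite row_mxEr mxE.
by rewrite row_mxEl mxE mul0r.
Unshelve. all: by end_near. Qed.

Lemma boxnbhs_slice n m (a : 'rV[R[i]]_n) (b : 'rV[R[i]]_m) P :
  boxnbhs (row_mx a b) P -> \forall x \near boxnbhs a, P (row_mx x b).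
Proof.
move=> [d d0 dP]; exists d => // x xa; apply: dP => j.
rewrite opp_row_mx add_row_mx subrr mxE; case: fintype.splitP => k _; first exact: xa.
by rewrite mxE Normc.normc0 ltW.
Qed.

Variables (K : numFieldType) (i : {rmorphism K -> R[i]}).
Hypothesis ii : isometric i.

Lemma near_embed n (a : 'rV[K]_n) P :
  boxnbhs (map_mx i a) P -> \forall x \near a, P (map_mx i x).
Proof.
move=> [d d0 dP]; apply/(nbhs_box _ _ ii); exists d => // x.
by rewrite map_mxB => /dP.
Qed.

Lemma near_row_mx n m (a : 'rV[K]_n) (b : 'rV[K]_m) (P : set 'rV[K]_(n + m)) :
  nbhs (row_mx a b) P -> \forall x \near a, \forall y \near b, P (row_mx x y).
Proof.
move=> /(nbhs_box _ _ ii)[d d0 dP].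
apply/(nbhs_box _ _ ii); exists d => // x xa.
apply/(nbhs_box _ _ ii); exists d => // y yb; apply: dP => j.
rewrite opp_row_mx add_row_mx map_row_mx mxE.
by case: fintype.splitP => k _; [exact: xa|exact: yb].
Qed.

Lemma near_0K (P : R -> Prop) : (\forall s \near 0^'+, P s) ->
  \forall h \near (0 : K)^', P (cmod (i h)).
Proof.
move=> [e /= e0 he]; have [k ke] := ii.2 e.
have k0 : 0 < k by rewrite -(isometric_gt0 _ ii) ke ltcR.
exists k => //= h /=; rewrite sub0r normrN => hk h0; apply: he => /=.
  rewrite sub0r normrN ger0_norm ?cmod_ge0// -ltcR -cmodE ii.1 -ke.
  by rewrite -subr_gt0 -rmorphB (isometric_gt0 _ ii) subr_gt0.
rewrite lt0r cmod_ge0 andbT; apply: contra h0 => /eqP /Normc.eq0_normc /eqP.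
by rewrite fmorph_eq0.
Qed.

End Slices.

Section LieGroupCharts.
Variables (K : numFieldType) (n : nat) (H : lieGroupType K n).
Implicit Types (g h : H).

Lemma chart_invK_at g : chart_inv (chart_at g) (chart_fun (chart_at g) g) = g.
Proof. by apply: chart_funK; exact: chart_at_dom. Qed.

Lemma chart1_inv1 : chart_inv (chart1 H) (chart_fun (chart1 H) 1%g) = 1%g.
Proof. exact: chart_invK_at. Qed.

Lemma near_chart g : \forall x \near chart_fun (chart_at g) g,
  chart_dom (chart_at g) (chart_inv (chart_at g) x) /\
  chart_fun (chart_at g) (chart_inv (chart_at g) x) = x.
Proof.
have : nbhs (chart_fun (chart_at g) g)
    (chart_fun (chart_at g) @` chart_dom (chart_at g)).
  apply: open_nbhs_nbhs; split; first exact: open_chart_img.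
  by exists g => //; exact: chart_at_dom.
by apply: filterS => _ [y yg <-]; rewrite chart_funK.
Qed.

Lemma translate_cvg g :
  (g * chart_inv (chart1 H) y)%g @[y --> chart_fun (chart1 H) 1%g] --> g.
Proof.
rewrite -[X in _ --> X]mulg1 -[X in _ --> (g * X)%g]chart1_inv1.
set b := chart_inv _ _.
apply: (@continuous2_cvg _ H H H (nbhs (chart_fun (chart1 H) 1%g)) _
  (fun=> g) (chart_inv (chart1 H)) (fun x y : H => (x * y)%g) g b).
- exact: (@lie_mulg_continuous K n H (g, b)).
- exact: cvg_cst.
- by apply: chart_inv_continuous; exact: chart_at_dom.
Qed.

End LieGroupCharts.

Section LeftExpansions.
Variables (R : realType) (K : numFieldType) (i : {rmorphism K -> R[i]}).
Hypothesis ii : isometric i.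
Variables (n : nat) (H : lieGroupType K n).
Implicit Types (f : H -> R[i]) (g : H) (v : 'rV[K]_n) (d : 'rV[R[i]]_n).

Local Notation c1 := (chart_fun (chart1 H) 1%g).
Local Notation inv1 := (chart_inv (chart1 H)).

(** Here [d] lists the derivatives of [f] at [g] along the standard
    left-invariant frame.  The quadratic control of [qdiff], unlike the mere
    existence of the limits in [lderiv], is preserved by composition. *)
Definition lexp f g d := exists2 Psi, qdiff Psi (map_mx i c1) d &
  \forall y \near c1, f (g * inv1 y)%g = Psi (map_mx i y).

Lemma lexp_quotient f g d v (eps : R) : lexp f g d -> 0 < eps ->
  \forall h \near (0 : K)^', cmod (dot (map_mx i v) d -
    (i h)^-1 * (f (g * inv1 (c1 + h *: v))%g - f g)) <= eps.
Proof.
move=> [Psi [M hM] /(nbhs_box _ _ ii)[e e0 fPsi]] eps0.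
have [t t0 vt] := inbox_exists (map_mx i v).
have f0 : f g = Psi (map_mx i c1).
  by rewrite -fPsi ?chart1_inv1 ?mulg1// subrr map_mx0; apply: inbox0; exact: ltW.
have Mt0 : 0 < `|M| * t ^+ 2 + 1 by rewrite ltr_wpDl// mulr_ge0// sqr_ge0.
have : \forall s \near 0^'+, (0 < s) /\ (s * t <= e) /\
    (`|M| * t ^+ 2 * s <= eps) /\
    (forall k, inbox (s * t) k ->
     cmod (Psi (map_mx i c1 + k) - Psi (map_mx i c1) - dot k d) <= M * (s * t) ^+ 2).
  near=> s; have s0 : 0 < s by near: s; exact: nbhs_right_gt.
  split=> //; split.
    by rewrite -ler_pdivlMr//; near: s; apply: nbhs_right_le; rewrite divr_gt0.
  split; last by near: s; exact: (near_scale t0 hM).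
  apply: (@le_trans _ _ (s * (`|M| * t ^+ 2 + 1))).
    by rewrite mulrC ler_wpM2l ?lerDl// ltW.
  by rewrite -ler_pdivlMr//; near: s; apply: nbhs_right_le; rewrite divr_gt0.
move=> /(near_0K ii); apply: filterS => h [h0 [he [hM' hk]]].
have hv : inbox (cmod (i h) * t) (map_mx i (h *: v)).
  by rewrite map_mxZ; exact: inboxZ.
rewrite fPsi; last by rewrite (addrC c1) addrK; exact: inboxW hv.
rewrite f0 map_mxD; have := hk _ hv.
rewrite map_mxZ dotZl; set D := Psi _ - _; set P := dot _ _ => hD.
have ih0 : i h != 0.
  by apply/negP => /eqP ih; move: h0; rewrite ih Normc.normc0 ltxx.
rewrite (_ : _ - _ = - ((i h)^-1 * (D - i h * P))).
  rewrite normcN Normc.normcM Normc.normcV; apply: le_trans hM'.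
  rewrite ler_pdivrMl//; apply: le_trans hD _.
  rewrite [leRHS](_ : _ = `|M| * (cmod (i h) * t) ^+ 2); last by ring.
  by rewrite ler_wpM2r ?sqr_ge0// ler_norm.
by rewrite [in RHS]mulrBr [in RHS]mulKf// opprB.
Unshelve. all: by end_near. Qed.

Lemma lexp_lderiv f g d v : lexp f g d ->
  lderiv (L := R[i]) i v f g = dot (map_mx i v) d.
Proof.
move=> fd; apply: (@cvg_lim (R[i] : numFieldType)); first exact: norm_hausdorff.
apply/cvgrPdist_le => eps' eps'0.
have [eps eps0 <-] : exists2 eps : R, 0 < eps & eps%:C%C = eps'.
  have E : (complex.Re eps')%:C%C = eps' by rewrite RRe_real// gtr0_real.
  by exists (complex.Re eps') => //; rewrite -ltcR E.
by apply: filterS (lexp_quotient v fd eps0) => h; rewrite -lecR -cmodE.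
Qed.

Lemma lexp_unique f g d d' : lexp f g d -> lexp f g d' -> d = d'.
Proof.
move=> fd fd'; apply/rowP => j.
have := lexp_lderiv (delta_mx 0 j) fd; rewrite (lexp_lderiv _ fd').
by rewrite map_delta_mx !dot_delta.
Qed.

Lemma lexp_ext f f' g d : (\forall x \near g, f x = f' x) ->
  lexp f g d -> lexp f' g d.
Proof.
move=> ff' [Psi hPsi fPsi]; exists Psi => //; near=> y.
have <- : f (g * inv1 y)%g = f' (g * inv1 y)%g.
  by near: y; exact: (translate_cvg ff').
by near: y.
Unshelve. all: by end_near. Qed.

Lemma lexp_lin f f' g d d' (c : R[i]) : lexp f g d -> lexp f' g d' ->
  lexp (fun x => c * f x + f' x) g (c *: d + d').
Proof.
move=> [P Pd fP] [P' P'd fP']; exists (fun y => c * P y + P' y).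
  exact: qdiff_lin.
by apply: filterS2 fP fP' => y -> ->.
Qed.

Lemma lexp0 g : lexp (fun _ => 0) g 0.
Proof.
exists (fun _ => 0); first exact: qdiff_cst.
by near=> y.
Unshelve. all: by end_near. Qed.

Lemma lexp_sum (I : Type) (r : seq I) (c : I -> R[i]) (F : I -> H -> R[i]) g
    (d : I -> 'rV[R[i]]_n) : (forall l, lexp (F l) g (d l)) ->
  lexp (fun x => \sum_(l <- r) c l * F l x) g (\sum_(l <- r) c l *: d l).
Proof.
move=> Fd; elim: r => [|l r IH].
  by rewrite big_nil; apply: lexp_ext (lexp0 g); near=> x; rewrite big_nil.
rewrite big_cons; apply: lexp_ext (lexp_lin _ (Fd l) IH).
by near=> x; rewrite big_cons.
Unshelve. all: by end_near. Qed.

Lemma lexp_coord j : lexp (fun x => i (chart_fun (chart1 H) x 0 j)) 1%g (delta_mx 0 j).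
Proof.
exists (fun y => y 0 j); first exact: qdiff_coord.
have := near_chart (1%g : H); apply: filterS => y [_ yK].
by rewrite mul1g yK mxE.
Qed.

End LeftExpansions.

(** * Left-invariant frames *)

(** Both fields of variables are treated at once through this predicate; the
    second part says that an analytic [K]-valued function remains analytic when
    regarded as complex-valued. *)
Definition analytic_field (R : realType) (K : numFieldType) (i : K -> R[i]) :=
  isometric i /\
  forall n (F : 'rV[K]_n -> K) a,
    analytic_at idfun F a -> analytic_at (L := R[i]) i (i \o F) a.

Lemma analytic_field_id (R : realType) : @analytic_field R R[i] idfun.
Proof. by split; first exact: isometric_id. Qed.

Lemma analytic_field_real (R : realType) : @analytic_field R R (real_complex R).
Proof.
by split; [exact: isometric_real|move=> n F a; exact: analytic_real_complex].
Qed.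

Section Frames.
Variables (R : realType) (K : numFieldType) (i : {rmorphism K -> R[i]}).
Hypothesis ai : analytic_field i.
Variables (n : nat) (H : lieGroupType K n).
Implicit Types (f : H -> R[i]) (g : H).

Let ii : isometric i := ai.1.
Local Notation c1 := (chart_fun (chart1 H) 1%g).
Local Notation inv1 := (chart_inv (chart1 H)).
Local Notation ct g := (chart_fun (chart_at g) g).

Lemma analytic_map_holo p q (F : 'rV[K]_p -> 'rV[K]_q) a :
  analytic_map_at idfun F a ->
  exists M : 'I_q -> 'rV[R[i]]_p -> R[i],
    (forall j, holo (M j) (map_mx i a)) /\
    \forall x \near a, map_mx i (F x) = \row_j M j (map_mx i x).
Proof.
move=> Fa.
have h j : exists M, holo M (map_mx i a) /\
    \forall x \near a, i (F x 0 j) = M (map_mx i x).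
  by have [M hM FM] := analytic_holo ii (ai.2 _ _ _ (Fa j)); exists M.
have [M hM] := choice h; exists M; split=> [j|]; first by have [] := hM j.
have hF := @filter_forall _ _ (fun j x => i (F x 0 j) = M j (map_mx i x))
  (nbhs a) (nbhs_filter a) (fun j => (hM j).2).
by apply: filterS hF => x Fx; apply/rowP => j; rewrite !mxE Fx.
Qed.

(** The frame at [g]: in the chart around [g], the left-invariant derivations
    are combinations of the coordinate derivations, with analytic coefficients
    that are read off from the multiplication map. *)
Definition frame_at g (A : 'I_n -> 'I_n -> 'rV[R[i]]_n -> R[i]) :=
  (forall l k, holo (A l k) (map_mx i (ct g))) /\
  forall f Phi, holo Phi (map_mx i (ct g)) ->
    (\forall x \near ct g, f (chart_inv (chart_at g) x) = Phi (map_mx i x)) ->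
    \forall x \near ct g, lexp i f (chart_inv (chart_at g) x)
      (\row_l \sum_k A l k (map_mx i x) * grad Phi (map_mx i x) 0 k).

Lemma frame_exists g : exists A, frame_at g A.
Proof.
pose mu z := chart_fun (chart_at g)
  (chart_inv (chart_at g) (lsubmx z) * inv1 (rsubmx z))%g.
have muA : analytic_map_at idfun mu (row_mx (ct g) c1).
  by have := lie_mulg_analytic g 1%g; rewrite mulg1.
have [M [hM Mmu]] := analytic_map_holo muA.
rewrite map_row_mx in hM.
exists (fun l k z => grad (M k) (row_mx z (map_mx i c1)) 0 (rshift n l)).
split=> [l k|f Phi hPhi fPhi].
  exact: (holo_slicel (holo_grad (rshift n l) (hM k))).
have near_mu := near_row_mx ii Mmu.
have near_M := @filter_forall _ _
  (fun j x => holo (M j) (row_mx (map_mx i x) (map_mx i c1))) (nbhs (ct g)) (nbhs_filter _)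
  (fun j => near_embed ii (boxnbhs_slice (holo_near (hM j)))).
have near_Phi := near_embed ii (holo_near hPhi).
have near_f := nbhs_interior fPhi.
near=> x.
have [xg xK] : chart_dom (chart_at g) (chart_inv (chart_at g) x) /\
  chart_fun (chart_at g) (chart_inv (chart_at g) x) = x by near: x; exact: near_chart.
have Mx : forall j, holo (M j) (row_mx (map_mx i x) (map_mx i c1)) by near: x.
have Phix : holo Phi (map_mx i x) by near: x.
have mux : \forall y \near c1, map_mx i (mu (row_mx x y)) = \row_j M j (map_mx i (row_mx x y)).
  by near: x.
have fx : \forall x' \near x, f (chart_inv (chart_at g) x') = Phi (map_mx i x').
  by near: x.
pose N y := \row_j M j (row_mx (map_mx i x) y).
have Nc : N (map_mx i c1) = map_mx i x.
  have := nbhs_singleton mux; rewrite map_row_mx -/(N _) => <-.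
  by rewrite /mu row_mxKl row_mxKr chart1_inv1 mulg1 xK.
exists (Phi \o N).
  pose D := \matrix_(l, k)
    grad (M k) (row_mx (map_mx i x) (map_mx i c1)) 0 (rshift n l).
  rewrite (_ : \row_l _ = \row_l \sum_k D l k * grad Phi (map_mx i x) 0 k); last first.
    by apply/rowP => l; rewrite !mxE; apply: eq_bigr => k _; rewrite mxE.
  apply: qdiff_comp => [|j].
  - by rewrite Nc; exact: holo_qdiff.
  - have := qdiff_slice (holo_qdiff (Mx j)).
    rewrite (_ : rsubmx _ = \row_l D l j).
      by apply: qdiff_ext; near=> y; rewrite /N mxE.
    by apply/rowP => l; rewrite !mxE.
have tr := @translate_cvg _ _ H (chart_inv (chart_at g) x).
have dom_y : \forall y \near c1,
    chart_dom (chart_at g) (chart_inv (chart_at g) x * inv1 y)%g.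
  by apply: tr; apply: open_nbhs_nbhs; split=> //; exact: open_chart_dom.
have cx : chart_fun (chart_at g) z @[z --> chart_inv (chart_at g) x] --> x.
  by rewrite -[X in _ --> X]xK; exact: chart_fun_continuous.
have f_y : \forall y \near c1,
    f (chart_inv (chart_at g) (chart_fun (chart_at g) (chart_inv (chart_at g) x * inv1 y)%g))
    = Phi (map_mx i (chart_fun (chart_at g) (chart_inv (chart_at g) x * inv1 y)%g)).
  exact: (tr _ (cx _ fx)).
near=> y.
have muy : map_mx i (mu (row_mx x y)) = \row_j M j (map_mx i (row_mx x y)) by near: y.
have fy : f (chart_inv (chart_at g) (chart_fun (chart_at g) (chart_inv (chart_at g) x * inv1 y)%g))
    = Phi (map_mx i (chart_fun (chart_at g) (chart_inv (chart_at g) x * inv1 y)%g)).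
  by near: y.
have yg : chart_dom (chart_at g) (chart_inv (chart_at g) x * inv1 y)%g by near: y.
rewrite chart_funK// in fy; rewrite fy /= /N -map_row_mx -muy.
by rewrite /mu row_mxKl row_mxKr.
Unshelve. all: by end_near. Qed.

Lemma frame_lexp g A f Phi : frame_at g A -> holo Phi (map_mx i (ct g)) ->
  (\forall x \near ct g, f (chart_inv (chart_at g) x) = Phi (map_mx i x)) ->
  lexp i f g (\row_l \sum_k A l k (map_mx i (ct g)) * grad Phi (map_mx i (ct g)) 0 k).
Proof.
by move=> [_ hA] hPhi /(hA _ _ hPhi) /nbhs_singleton; rewrite chart_invK_at.
Qed.

Lemma frame1 A l k : frame_at (1%g : H) A -> A l k (map_mx i c1) = (l == k)%:R.
Proof.
move=> hA; pose f x := i (chart_fun (chart1 H) x 0 k).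
have fE : \forall x \near c1, f (inv1 x) = map_mx i x 0 k.
  by have := near_chart (1%g : H); apply: filterS => x [_ xK]; rewrite /f xK mxE.
have := lexp_unique ii (lexp_coord i H k) (frame_lexp hA (holo_coord k _) fE).
move=> /rowP/(_ l); rewrite !mxE eqxx /= (grad_eq (qdiff_coord _ _)).
rewrite (bigD1 k)//= big1 ?addr0 => [|k' kk'].
  by rewrite mxE !eqxx mulr1 => <-.
by rewrite mxE (negbTE kk') andbF mulr0.
Qed.

(** The frame is invertible because left translation by the inverse of [g]
    maps back to the identity. *)
Lemma frame_unit g A : frame_at g A ->
  \matrix_(l, k) A l k (map_mx i (ct g)) \in unitmx.
Proof.
move=> hA.
pose nu z := chart_fun (chart1 H) (chart_inv (chart_at g^-1%g) (lsubmx z) *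
  chart_inv (chart_at g) (rsubmx z))%g.
have nuA : analytic_map_at idfun nu (row_mx (ct g^-1%g) (ct g)).
  by have := lie_mulg_analytic g^-1%g g; rewrite mulVg.
have [M [hM Mnu]] := analytic_map_holo nuA.
rewrite map_row_mx in hM.
have near_nu := nbhs_singleton (near_row_mx ii Mnu).
(* Along the frame at [g] these functions have the standard basis as gradients. *)
pose f j x := i (chart_fun (chart1 H) (g^-1 * x)%g 0 j).
pose Phi j z := M j (row_mx (map_mx i (ct g^-1%g)) z).
have fPhi j : \forall x \near ct g, f j (chart_inv (chart_at g) x) = Phi j (map_mx i x).
  apply: filterS near_nu => x /rowP/(_ j); rewrite !mxE map_row_mx -/(Phi j _) => <-.
  by rewrite /nu row_mxKl row_mxKr chart_invK_at.
have f_lexp j : lexp i (f j) g (delta_mx 0 j).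
  exists (fun y => y 0 j); first exact: qdiff_coord.
  have := near_chart (1%g : H); apply: filterS => y [_ yK].
  by rewrite /f mulKg yK mxE.
have E j := lexp_unique ii (f_lexp j) (frame_lexp hA (holo_slicer (hM j)) (fPhi j)).
have AB : (\matrix_(l, k) A l k (map_mx i (ct g))) *m
    (\matrix_(k, j) grad (Phi j) (map_mx i (ct g)) 0 k) = 1%:M.
  apply/matrixP => l j; have /rowP/(_ l) := E j; rewrite !mxE eqxx /= => ->.
  by apply: eq_bigr => k _; rewrite !mxE.
by have [] := mulmx1_unit AB.
Qed.

End Frames.

(** * Left-invariant derivations *)

Section Derivations.
Variables (R : realType) (K : numFieldType) (i : {rmorphism K -> R[i]}).
Hypothesis ai : analytic_field i.
Variables (n : nat) (H : lieGroupType K n).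
Implicit Types (f : H -> R[i]) (g : H) (v w : 'rV[K]_n).

Let ii : isometric i := ai.1.
Local Notation c1 := (chart_fun (chart1 H) 1%g).
Local Notation inv1 := (chart_inv (chart1 H)).
Local Notation ct g := (chart_fun (chart_at g) g).
Local Notation D v := (lderiv (L := R[i]) i v).
Local Notation e_ l := (delta_mx 0 l).

(** Complex-valued functions which, in the chart around [g], are restrictions of
    holomorphic functions of the coordinates. *)
Definition holo_at f g := exists2 Phi, holo Phi (map_mx i (ct g)) &
  \forall x \near ct g, f (chart_inv (chart_at g) x) = Phi (map_mx i x).

Lemma analytic_holo_at (W : set H) f g :
  analytic_on (L := R[i]) i W f -> W g -> holo_at f g.
Proof. by move=> fW /fW/(analytic_holo ii)[Phi hPhi fPhi]; exists Phi. Qed.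

Lemma holo_at_lexp f g : holo_at f g -> lexp i f g (\row_l D (e_ l) f g).
Proof.
move=> [Phi hPhi fPhi]; have [A hA] := frame_exists ai g.
have := frame_lexp hA hPhi fPhi; set d := \row_l _ => fd.
rewrite (_ : \row_l _ = d)//; apply/rowP => l.
by rewrite mxE (lexp_lderiv ii _ fd) map_delta_mx dot_delta.
Qed.

Lemma near_lexp f g : holo_at f g -> \forall z \near g, exists d, lexp i f z d.
Proof.
move=> [Phi hPhi fPhi]; have [A hA] := frame_exists ai g.
have fz := chart_fun_continuous (chart_at_dom g) (hA.2 _ _ hPhi fPhi).
have dz : \forall z \near g, chart_dom (chart_at g) z.
  by apply: open_nbhs_nbhs; split; [exact: open_chart_dom|exact: chart_at_dom].
by apply: filterS2 dz fz => z zg /=; rewrite chart_funK//; eexists; eassumption.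
Qed.

Lemma lexp_basis f g d v : lexp i f g d ->
  D v f g = \sum_l i (v 0 l) * D (e_ l) f g.
Proof.
move=> fd; rewrite (lexp_lderiv ii v fd) /dot; apply: eq_bigr => l _.
by rewrite mxE (lexp_lderiv ii _ fd) map_delta_mx dot_delta.
Qed.

Lemma near_chart_inv g (P : set H) : nbhs g P ->
  \forall x \near ct g, P (chart_inv (chart_at g) x).
Proof.
move=> gP; apply: (chart_inv_continuous (chart_at_dom g)).
by rewrite chart_invK_at.
Qed.

Lemma holo_at_ext f f' g : (\forall x \near g, f x = f' x) ->
  holo_at f g -> holo_at f' g.
Proof.
move=> /near_chart_inv ff' [Phi hPhi fPhi]; exists Phi => //.
by apply: filterS2 ff' fPhi => x -> ->.
Qed.

Lemma lderiv_near v f f' g : (\forall x \near g, f x = f' x) ->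
  holo_at f g -> D v f g = D v f' g.
Proof.
move=> ff' /holo_at_lexp fd.
by rewrite (lexp_lderiv ii v fd) (lexp_lderiv ii v (lexp_ext ff' fd)).
Qed.

Lemma lderiv_basis v f g : holo_at f g ->
  D v f g = \sum_l i (v 0 l) * D (e_ l) f g.
Proof. by move=> /holo_at_lexp/lexp_basis. Qed.

Lemma holo_at_cst c g : holo_at (fun=> c) g.
Proof. by exists (fun=> c); [exact: holo_cst | near=> x]. Unshelve. all: by end_near. Qed.

Lemma holo_at_lin c f f' g : holo_at f g -> holo_at f' g ->
  holo_at (fun x => c * f x + f' x) g.
Proof.
move=> [Phi hPhi fPhi] [Phi' hPhi' fPhi']; exists (fun z => c * Phi z + Phi' z).
  by apply: holoD => //; apply: holoM => //; exact: holo_cst.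
by apply: filterS2 fPhi fPhi' => x -> ->.
Qed.

Lemma holo_at_sum (I : Type) (r : seq I) (c : I -> R[i]) (F : I -> H -> R[i]) g :
  (forall l, holo_at (F l) g) -> holo_at (fun x => \sum_(l <- r) c l * F l x) g.
Proof.
move=> Fg; elim: r => [|l r IH].
  by apply: holo_at_ext (holo_at_cst 0 g); near=> x; rewrite big_nil.
by apply: holo_at_ext (holo_at_lin (c l) (Fg l) IH); near=> x; rewrite big_cons.
Unshelve. all: by end_near. Qed.

Lemma lderiv_sum v (I : Type) (r : seq I) (c : I -> R[i]) (F : I -> H -> R[i]) g :
  (forall l, holo_at (F l) g) ->
  D v (fun x => \sum_(l <- r) c l * F l x) g = \sum_(l <- r) c l * D v (F l) g.
Proof.
move=> Fg; have Fd l := holo_at_lexp (Fg l).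
rewrite (lexp_lderiv ii v (lexp_sum r c Fd)).
rewrite /dot; under eq_bigr do rewrite summxE mulr_sumr.
rewrite exchange_big; apply: eq_bigr => l _ /=.
rewrite (lexp_lderiv ii v (Fd l)) /dot mulr_sumr.
by apply: eq_bigr => j _; rewrite !mxE mulrCA.
Qed.

Section InFrame.
Variables (g : H) (A : 'I_n -> 'I_n -> 'rV[R[i]]_n -> R[i]).
Hypothesis hA : frame_at i g A.
Variables (f : H -> R[i]) (Phi : 'rV[R[i]]_n -> R[i]).
Hypothesis hPhi : holo Phi (map_mx i (ct g)).
Hypothesis fPhi : \forall x \near ct g, f (chart_inv (chart_at g) x) = Phi (map_mx i x).

Definition frame_deriv v (z : 'rV[R[i]]_n) :=
  \sum_l i (v 0 l) * \sum_k A l k z * grad Phi z 0 k.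

Lemma holo_frame_deriv v : holo (frame_deriv v) (map_mx i (ct g)).
Proof.
apply: holo_sum => l; apply: holoM; first exact: holo_cst.
by apply: holo_sum => k; apply: holoM; [exact: hA.1|exact: holo_grad].
Qed.

Lemma lderiv_frame v : \forall x \near ct g,
  D v f (chart_inv (chart_at g) x) = frame_deriv v (map_mx i x).
Proof.
have := hA.2 _ _ hPhi fPhi; apply: filterS => x /(lexp_lderiv ii v) ->.
by apply: eq_bigr => l _; rewrite !mxE.
Qed.

End InFrame.

Lemma holo_at_lderiv v f g : holo_at f g -> holo_at (D v f) g.
Proof.
move=> [Phi hPhi fPhi]; have [A hA] := frame_exists ai g.
exists (frame_deriv A Phi v); first exact: holo_frame_deriv.
exact: lderiv_frame.
Qed.

(** At the identity the commutator of two left-invariant derivations is a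
    derivation: the second derivatives of the function cancel. *)
Lemma commutator_derivation v w : exists gamma : 'I_n -> R[i],
  forall f, holo_at f 1%g ->
    D v (D w f) 1%g - D w (D v f) 1%g = \sum_k gamma k * D (e_ k) f 1%g.
Proof.
have [A hA] := frame_exists ai (1%g : H); set a := map_mx i c1.
pose beta v w k := \sum_l \sum_l' i (v 0 l') * i (w 0 l) * grad (A l k) a 0 l'.
(* The derivatives along [v] of the coefficients of the field of [w], minus those
   along [w] of the coefficients of the field of [v]. *)
exists (fun k => beta v w k - beta w v k) => f [Phi hPhi fPhi].
have fd1 (P : 'rV[R[i]]_n -> R[i]) (F : H -> R[i]) u : holo P a ->
    (\forall x \near c1, F (inv1 x) = P (map_mx i x)) ->
    D u F 1%g = \sum_l i (u 0 l) * grad P a 0 l.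
  move=> hP FP; rewrite (lexp_lderiv ii u (frame_lexp hA hP FP)) /dot.
  apply: eq_bigr => l _; rewrite !mxE; congr (_ * _).
  rewrite (bigD1 l)//= big1 ?addr0 => [|k kl]; rewrite (frame1 ai _ _ hA).
    by rewrite eqxx mul1r.
  by rewrite eq_sym (negbTE kl) mul0r.
have dPhi k : D (e_ k) f 1%g = grad Phi a 0 k.
  rewrite (fd1 Phi)// (bigD1 k)//= big1 ?addr0 => [|l lk]; rewrite mxE eqxx /=.
    by rewrite eqxx rmorph1 mul1r.
  by rewrite (negbTE lk) rmorph0 mul0r.
have second u u' : D u (D u' f) 1%g =
    \sum_l \sum_l' i (u 0 l') * i (u' 0 l) *
      grad (fun z => grad Phi z 0 l) a 0 l' +
    \sum_k beta u u' k * grad Phi a 0 k.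
  rewrite (fd1 (frame_deriv A Phi u')); last 2 first.
  - exact: holo_frame_deriv.
  - exact: lderiv_frame.
  have gAk l k : qdiff (fun z => A l k z * grad Phi z 0 k) a
      (A l k a *: grad (fun z => grad Phi z 0 k) a + grad Phi a 0 k *: grad (A l k) a).
    by apply: qdiff_mul; apply: holo_qdiff; [exact: hA.1|exact: holo_grad].
  have qsum (I : Type) (r : seq I) (c : I -> R[i]) (F : I -> 'rV[R[i]]_n -> R[i])
      (d : I -> 'rV[R[i]]_n) : (forall l, qdiff (F l) a (d l)) ->
      qdiff (fun z => \sum_(l <- r) c l * F l z) a (\sum_(l <- r) c l *: d l).
    move=> Fd; elim: r => [|l r IH].
      rewrite big_nil; apply: qdiff_ext (qdiff_cst 0 a).
      by near=> z; rewrite big_nil.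
    rewrite big_cons; apply: qdiff_ext (qdiff_lin (c l) (Fd l) IH).
    by near=> z; rewrite big_cons.
  have gl l : qdiff (fun z => \sum_k A l k z * grad Phi z 0 k) a
      (\sum_k 1 *: (A l k a *: grad (fun z => grad Phi z 0 k) a + grad Phi a 0 k *: grad (A l k) a)).
    apply: qdiff_ext (qsum _ _ (fun=> 1) _ _ (gAk l)).
    by near=> z; apply: eq_bigr => k _; rewrite mul1r.
  rewrite (grad_eq (qsum _ _ _ _ _ gl)).
  under eq_bigr do rewrite summxE mulr_sumr.
  rewrite exchange_big /=.
  transitivity (\sum_l \sum_l' (i (u 0 l') * i (u' 0 l) *
      grad (fun z => grad Phi z 0 l) a 0 l' +
      \sum_k i (u 0 l') * i (u' 0 l) * grad (A l k) a 0 l' * grad Phi a 0 k)).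
    apply: eq_bigr => l _; apply: eq_bigr => l' _.
    rewrite mxE summxE.
    under eq_bigr do rewrite !mxE mul1r (frame1 ai _ _ hA).
    rewrite big_split /= (bigD1 l)//= [X in _ + X + _]big1 ?addr0 => [|k kl].
      rewrite eqxx mul1r !mulrDr mulrA; congr (_ + _).
      by rewrite !mulr_sumr; apply: eq_bigr => k _; ring.
    by rewrite eq_sym (negbTE kl) mul0r.
  under [LHS]eq_bigr do rewrite big_split /=.
  rewrite big_split /=; congr (_ + _).
  under [RHS]eq_bigr do rewrite mulr_suml.
  rewrite [RHS]exchange_big /=; apply: eq_bigr => l _.
  under [RHS]eq_bigr do rewrite mulr_suml.
  by rewrite exchange_big.
rewrite !second.
have -> : \sum_l \sum_l' i (w 0 l') * i (v 0 l) * grad (fun z => grad Phi z 0 l) a 0 l'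
  = \sum_l \sum_l' i (v 0 l') * i (w 0 l) * grad (fun z => grad Phi z 0 l) a 0 l'.
  rewrite exchange_big; apply: eq_bigr => l _; apply: eq_bigr => l' _.
  by rewrite (gradC _ _ hPhi) (mulrC (i _)).
rewrite opprD addrACA subrr add0r -sumrB; apply: eq_bigr => k _.
by rewrite dPhi mulrBl.
Unshelve. all: by end_near. Qed.

End Derivations.

(** * Real subgroups of complex groups *)

Section RealBracket.
Variables (R : realType) (n : nat) (H : lieGroupType R n).
Local Notation rc := (real_complex R).
Local Notation c1 := (chart_fun (chart1 H) 1%g).
Local Notation inv1 := (chart_inv (chart1 H)).
Local Notation D v := (lderiv (L := R[i]) rc v).
Let ar := analytic_field_real R.

(** The difference quotients are real, hence so is their complex limit. *)
Lemma lderiv_real (u : H -> R) g v d :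
  lexp rc (fun x => (u x)%:C%C) g d ->
  (lderiv idfun v u g)%:C%C = D v (fun x => (u x)%:C%C) g.
Proof.
move=> ud; rewrite (lexp_lderiv ar.1 v ud); set P := dot _ d.
have quot (eps : R) : 0 < eps -> \forall h \near (0 : R)^',
    cmod (P - (h^-1 * (u (g * inv1 (c1 + h *: v))%g - u g))%:C%C) <= eps.
  move=> eps0; have := lexp_quotient ar.1 v ud eps0; apply: filterS => h.
  by rewrite rmorphM rmorphB fmorphV.
have -> : P = (complex.Re P)%:C%C.
  apply/eqP; rewrite eq_complex /= eqxx /=; apply/eqP/normr0_eq0/eqP.
  rewrite eq_le normr_ge0 andbT; apply: (@le_epsilon _ _ _ 1) => eps /andP[eps0 _].
  rewrite mul1r addr0; near (0:R)^' => h; have : cmod (P - (h^-1 *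
      (u (g * inv1 (c1 + h *: v))%g - u g))%:C%C) <= eps by near: h; exact: quot.
  by apply: le_trans; apply: le_trans (cmod_Im _); rewrite ImB /= subr0.
congr (_%:C%C); apply: cvg_lim; first exact: norm_hausdorff.
apply/cvgrPdist_le => eps /quot; apply: filterS => h; apply: le_trans.
by apply: le_trans (cmod_Re _); rewrite ReB.
Unshelve. all: by end_near. Qed.

Lemma holo_at_coord (K : numFieldType) (i : {rmorphism K -> R[i]}) m (G : lieGroupType K m) (j : 'I_m) :
  holo_at i (fun x : G => i (chart_fun (chart1 G) x 0 j)) 1%g.
Proof.
exists (fun z => z 0 j); first exact: holo_coord.
by have := near_chart (1%g : G); apply: filterS => x [_ xK]; rewrite xK mxE.
Qed.

(** The Lie bracket is defined through the coordinate functions; it computes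
    the commutator on every function because the commutator is a derivation. *)
Lemma bracket_commutator v w (f : H -> R[i]) : holo_at rc f 1%g ->
  D v (D w f) 1%g - D w (D v f) 1%g = D (lie_bracket H v w) f 1%g.
Proof.
move=> hf; have [gamma hg] := commutator_derivation ar H v w.
pose x_ j (z : H) := chart_fun (chart1 H) z 0 j.
have hx j : holo_at rc (fun z => (x_ j z)%:C%C) 1%g := holo_at_coord rc H j.
have second u u' j : D u (D u' (fun z => (x_ j z)%:C%C)) 1%g =
    (lderiv idfun u (lderiv idfun u' (x_ j)) 1%g)%:C%C.
  have E : \forall z \near (1%g : H), D u' (fun z => (x_ j z)%:C%C) z =
      (lderiv idfun u' (x_ j) z)%:C%C.
    by have := near_lexp ar (hx j); apply: filterS => z [d /lderiv_real ->].
  have hD := holo_at_lderiv ar u' (hx j).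
  rewrite (lderiv_near ar u E hD).
  by rewrite -(lderiv_real u (holo_at_lexp ar (holo_at_ext E hD))).
have gE j : gamma j = (lie_bracket H v w 0 j)%:C%C.
  transitivity (\sum_k gamma k * D (delta_mx 0 k) (fun z => (x_ j z)%:C%C) 1%g).
    rewrite (bigD1 j)//= big1 ?addr0 => [|k kj];
      rewrite (lexp_lderiv ar.1 _ (lexp_coord rc H j)) map_delta_mx dot_delta mxE eqxx /=.
      by rewrite eqxx mulr1.
    by rewrite (negbTE kj) mulr0.
  by rewrite -hg// !second mxE -rmorphB.
rewrite hg// (lderiv_basis ar (lie_bracket H v w) hf).
by apply: eq_bigr => k _; rewrite gE.
Qed.

End RealBracket.

Section Naturality.
Variables (R : realType) (n m : nat).
Variables (GC : lieGroupType R[i] m) (H : lieGroupType R n) (iota : H -> GC).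
Hypothesis sub : lie_subgroup iota.
Local Notation rc := (real_complex R).
Local Notation D v := (lderiv (L := R[i]) rc v).
Local Notation DC v := (lderiv (L := R[i]) (@idfun R[i]) v).
Local Notation c1 := (chart_fun (chart1 H) 1%g).
Local Notation inv1 := (chart_inv (chart1 H)).
Local Notation C1 := (chart_fun (chart1 GC) 1%g).
Let ar := analytic_field_real R.
Let ac := analytic_field_id R.

Lemma subgroup1 : iota 1%g = 1%g.
Proof.
have [_ iM _ _ _] := sub; apply: (mulgI (iota 1%g)).
by rewrite -iM !mulg1.
Qed.

Definition dincl_mx : 'M[R[i]]_(n, m) := \matrix_(l, j) dincl iota (delta_mx 0 l) 0 j.

Lemma subgroup_coordinates : exists N : 'I_m -> 'rV[R[i]]_n -> R[i],
  [/\ forall j, holo (N j) (map_mx rc c1),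
      \forall y \near c1, chart_fun (chart1 GC) (iota (inv1 y)) = \row_j N j (map_mx rc y) &
      forall j, grad (N j) (map_mx rc c1) = (\row_l dincl_mx l j)].
Proof.
have [_ _ _ /(_ 1%g) ia _] := sub; rewrite subgroup1 in ia.
have h j : exists N, holo N (map_mx rc c1) /\
    \forall y \near c1, chart_fun (chart1 GC) (iota (inv1 y)) 0 j = N (map_mx rc y).
  by have [N hN FN] := analytic_holo ar.1 (ia j); exists N.
have [N hN] := choice h; exists N; split=> [j| |j]; first by have [] := hN j.
  have := @filter_forall _ _ (fun j y => chart_fun (chart1 GC) (iota (inv1 y)) 0 j
     = N j (map_mx rc y)) (nbhs c1) (nbhs_filter _) (fun j => (hN j).2).
  by apply: filterS => y yN; apply/rowP => j; rewrite mxE yN.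
have xj : lexp rc (fun x => chart_fun (chart1 GC) (iota x) 0 j) 1%g
    (grad (N j) (map_mx rc c1)).
  exists (N j); first exact: holo_qdiff (hN j).1.
  by have := (hN j).2; apply: filterS => y <-; rewrite mul1g.
apply/rowP => l; rewrite !mxE (lexp_lderiv ar.1 _ xj).
by rewrite map_delta_mx dot_delta.
Qed.

Lemma dinclE v : dincl iota v = map_mx rc v *m dincl_mx.
Proof.
have [N [hN Niota gN]] := subgroup_coordinates.
apply/rowP => j; rewrite !mxE.
have xj : lexp rc (fun x => chart_fun (chart1 GC) (iota x) 0 j) 1%g
    (grad (N j) (map_mx rc c1)).
  exists (N j); first exact: holo_qdiff.
  by apply: filterS Niota => y yN; rewrite mul1g yN mxE.
rewrite (lexp_lderiv ar.1 _ xj) /dot gN.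
by apply: eq_bigr => l _; rewrite mxE.
Qed.

(** The inclusion commutes with left translations, so that only its expansion at
    the identity, that is [dincl_mx], enters the chain rule. *)
Lemma natural_lexp (f : H -> R[i]) (F : GC -> R[i]) g d :
  lexp (@idfun R[i]) F (iota g) d -> (\forall x \near g, f x = F (iota x)) ->
  lexp rc f g (\row_l \sum_j dincl_mx l j * d 0 j).
Proof.
move=> [Psi Psid FPsi] fF; have [N [hN Niota gN]] := subgroup_coordinates.
have [_ iM ic _ _] := sub.
have NC : \row_j N j (map_mx rc c1) = C1.
  by have := nbhs_singleton Niota; rewrite chart1_inv1 subgroup1.
exists (Psi \o (fun y => \row_j N j y)).
  apply: qdiff_comp => [|j]; first by rewrite NC; rewrite map_mx_id in Psid.
  rewrite -gN; apply: qdiff_ext (holo_qdiff (hN j)).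
  by near=> y; rewrite mxE.
have cvg1 : iota (inv1 y) @[y --> c1] --> (1%g : GC).
  by move=> P /=; rewrite -{1}subgroup1 => /(ic 1%g) /near_chart_inv.
have dom_y : \forall y \near c1, chart_dom (chart1 GC) (iota (inv1 y)).
  apply: cvg1; apply: open_nbhs_nbhs; split; first exact: open_chart_dom.
  exact: chart_at_dom.
have cC : chart_fun (chart1 GC) z @[z --> (1%g : GC)] --> C1.
  by apply: chart_fun_continuous; exact: chart_at_dom.
have FPsi_y : \forall y \near c1, F (iota g * chart_inv (chart1 GC)
     (chart_fun (chart1 GC) (iota (inv1 y))))%g =
    Psi (map_mx idfun (chart_fun (chart1 GC) (iota (inv1 y)))).
  exact: (cvg1 _ (cC _ FPsi)).
have f_y : \forall y \near c1, f (g * inv1 y)%g = F (iota (g * inv1 y)%g).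
  exact: translate_cvg fF.
near=> y.
have -> : f (g * inv1 y)%g = F (iota (g * inv1 y)%g) by near: y.
have yd : chart_dom (chart1 GC) (iota (inv1 y)) by near: y.
have yN : chart_fun (chart1 GC) (iota (inv1 y)) = \row_j N j (map_mx rc y) by near: y.
have yF : F (iota g * chart_inv (chart1 GC)
     (chart_fun (chart1 GC) (iota (inv1 y))))%g =
    Psi (map_mx idfun (chart_fun (chart1 GC) (iota (inv1 y)))) by near: y.
by rewrite map_mx_id// chart_funK// in yF; rewrite iM /= -yN yF.
Unshelve. all: by end_near. Qed.

Lemma natural_lderiv v (f : H -> R[i]) (F : GC -> R[i]) g d :
  lexp (@idfun R[i]) F (iota g) d -> (\forall x \near g, f x = F (iota x)) ->
  D v f g = DC (dincl iota v) F (iota g).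
Proof.
move=> Fd fF; rewrite (lexp_lderiv ar.1 v (natural_lexp Fd fF)).
rewrite (lexp_lderiv ac.1 _ Fd) map_mx_id// dinclE /dot.
under eq_bigr do rewrite [X in _ * X]mxE mulr_sumr.
rewrite exchange_big; apply: eq_bigr => j _; rewrite [in RHS]mxE mulr_suml.
by apply: eq_bigr => l _; rewrite mulrA.
Qed.

(** Both sides are commutators evaluated on the coordinates of the complex group
    at the identity, along the subgroup and along the complex group. *)
Lemma dincl_bracket v w : dincl iota (lie_bracket H v w) =
  lie_bracket GC (dincl iota v) (dincl iota w).
Proof.
have [N [hN Niota gN]] := subgroup_coordinates; have [_ _ ic _ _] := sub.
apply/rowP => j; rewrite [LHS]mxE [RHS]mxE.
pose X (x : GC) := chart_fun (chart1 GC) x 0 j.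
have hX : holo_at (@idfun R[i]) X 1%g := holo_at_coord (@idfun R[i]) GC j.
have hf : holo_at rc (X \o iota) 1%g.
  by exists (N j) => //; apply: filterS Niota => y yN; rewrite /= /X yN mxE.
have second u u' : D u (D u' (X \o iota)) 1%g =
    DC (dincl iota u) (DC (dincl iota u') X) 1%g.
  have h1 : \forall z \near (1%g : H), D u' (X \o iota) z = DC (dincl iota u') X (iota z).
    have P : \forall x \near iota 1%g, exists d, lexp (@idfun R[i]) X x d.
      by rewrite subgroup1; have Q := near_lexp ac hX; exact: Q.
    have : \forall z \near (1%g : H), exists d, lexp (@idfun R[i]) X (iota z) d.
      exact: (ic 1%g _ P).
    apply: filterS => z [d Xd]; apply: natural_lderiv Xd _.
    by near=> x.
  have := holo_at_lexp ac (holo_at_lderiv ac (dincl iota u') hX).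
  set d := \row_l _ => Fd; rewrite -subgroup1 in Fd.
  by rewrite (natural_lderiv u Fd h1) subgroup1.
by rewrite -(bracket_commutator v w hf) !second.
Unshelve. all: by end_near. Qed.

End Naturality.

(** * The Laplace-Beltrami operators of real forms *)

Section ComplexLieAlgebra.
Variables (R : realType) (m : nat) (GC : lieGroupType R[i] m).
Local Notation DC v := (lderiv (L := R[i]) (@idfun R[i]) v).
Local Notation e_ l := (delta_mx 0 l).
Let ac := analytic_field_id R.

Definition ad (v : 'rV[R[i]]_m) : 'M[R[i]]_m := lin1_mx (lie_bracket GC v).

Lemma bracket_anti (K : numFieldType) n (G : lieGroupType K n) v w :
  lie_bracket G v w = - lie_bracket G w v.
Proof. by apply/rowP => j; rewrite !mxE opprB. Qed.

Lemma bracket_sumr v w :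
  lie_bracket GC v w = \sum_l w 0 l *: lie_bracket GC v (e_ l).
Proof.
apply/rowP => j; rewrite summxE [LHS]mxE.
pose X (x : GC) := chart_fun (chart1 GC) x 0 j.
have hX : holo_at (@idfun R[i]) X 1%g := holo_at_coord (@idfun R[i]) GC j.
have E : \forall x \near (1%g : GC), DC w X x = \sum_l w 0 l * DC (e_ l) X x.
  have := near_lexp ac hX; apply: filterS => x [d Xd].
  exact: (lexp_basis ac w Xd).
have h1 := lderiv_near ac v E (holo_at_lderiv ac w hX).
have h2 := @lderiv_sum _ _ _ ac _ _ v _ (index_enum 'I_m) (fun l => w 0 l)
  (fun l => DC (e_ l) X) 1%g (fun l => holo_at_lderiv ac (e_ l) hX).
have h3 := lderiv_basis ac w (holo_at_lderiv ac v hX).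
transitivity (\sum_l w 0 l * DC v (DC (e_ l) X) 1%g -
  \sum_l w 0 l * DC (e_ l) (DC v X) 1%g).
  by congr (_ - _); [rewrite -h2; exact: h1|exact: h3].
rewrite -sumrB; apply: eq_bigr => l _.
by rewrite [RHS]mxE [in RHS]mxE mulrBr.
Qed.

Lemma bracket_ad v w : lie_bracket GC v w = w *m ad v.
Proof.
rewrite bracket_sumr; apply/rowP => j; rewrite summxE [RHS]mxE.
by apply: eq_bigr => l _; rewrite [LHS]mxE [in RHS]mxE.
Qed.

Lemma ad_sum v : ad v = \sum_l v 0 l *: ad (e_ l).
Proof.
have adE u a b : ad u a b = lie_bracket GC u (e_ a) 0 b by rewrite mxE.
have scE (c : R[i]) (u : 'rV[R[i]]_m) b : (c *: u) 0 b = c * u 0 b by rewrite mxE.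
have opE (u : 'rV[R[i]]_m) b : (- u) 0 b = - u 0 b by rewrite mxE.
apply/matrixP => a b; rewrite adE bracket_anti opE bracket_sumr !summxE -sumrN.
apply: eq_bigr => l _; rewrite scE [RHS]mxE adE.
by rewrite [in RHS]bracket_anti opE mulrN.
Qed.

Definition killing_mx : 'M[R[i]]_m :=
  \matrix_(j, k) killing GC (e_ j) (e_ k).

Lemma killing_ad v w : killing GC v w = \tr (ad v *m ad w).
Proof. by []. Qed.

Lemma killingC v w : killing GC v w = killing GC w v.
Proof. exact: (mxtrace_mulC (ad v) (ad w)). Qed.

Lemma killingE v w : killing GC v w = (v *m killing_mx *m w^T) 0 0.
Proof.
rewrite killing_ad (ad_sum v) (ad_sum w).
have -> : (\sum_l v 0 l *: ad (e_ l)) *m (\sum_l w 0 l *: ad (e_ l)) =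
    \sum_l \sum_k v 0 l * w 0 k *: (ad (e_ l) *m ad (e_ k)).
  rewrite mulmx_suml; apply: eq_bigr => l _; rewrite mulmx_sumr.
  by apply: eq_bigr => k _; rewrite -scalemxAl -scalemxAr scalerA.
rewrite raddf_sum [RHS]mxE /=.
under [RHS]eq_bigr => k _ do rewrite [X in X * _]mxE mulr_suml.
rewrite [RHS]exchange_big /=; apply: eq_bigr => j _.
rewrite raddf_sum /=; apply: eq_bigr => k _.
have -> : killing_mx j k = \tr (ad (e_ j) *m ad (e_ k)) by rewrite mxE.
by rewrite mxtraceZ [w^T k 0]mxE mulrAC.
Qed.

Lemma tr_ad v : \tr (ad v) = \sum_l v 0 l * \tr (ad (e_ l)).
Proof.
by rewrite {1}ad_sum linear_sum; apply: eq_bigr => l _; rewrite /= mxtraceZ.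
Qed.

(** The holomorphic operator of which the Laplace-Beltrami operators of all
    real forms of [GC] are restrictions. *)
Definition complex_laplacian (Q : 'M[R[i]]_m) (F : GC -> R[i]) (x : GC) : R[i] :=
  \sum_(p : 'I_m * 'I_m) Q p.1 p.2 *
    (- \tr (ad (e_ p.1)) * DC (e_ p.2) F x + DC (e_ p.1) (DC (e_ p.2) F) x).

Definition holo_on (W : set GC) (F : GC -> R[i]) :=
  forall x, W x -> holo_at (@idfun R[i]) F x.

Lemma holo_on_lderiv W v F : holo_on W F -> holo_on W (DC v F).
Proof. by move=> FW x /FW Fx; have := holo_at_lderiv ac v Fx. Qed.

Lemma holo_on_laplacian W Q F : holo_on W F -> holo_on W (complex_laplacian Q F).
Proof.
move=> FW x Wx; apply: holo_at_sum => p; apply: holo_at_lin.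
  exact: (holo_on_lderiv (e_ p.2) FW Wx).
exact: (holo_on_lderiv (e_ p.1) (holo_on_lderiv (e_ p.2) FW) Wx).
Qed.

End ComplexLieAlgebra.

Section RealForm.
Variables (R : realType) (m : nat).
Variables (GC : lieGroupType R[i] m) (H : lieGroupType R m) (iota : H -> GC).
Hypothesis sub : lie_subgroup iota.
Local Notation B := (dincl_mx iota).
Hypothesis B_unit : B \in unitmx.
Variable lambda : R.
Local Notation rc := (real_complex R).
Local Notation D v := (lderiv (L := R[i]) rc v).
Local Notation DC v := (lderiv (L := R[i]) (@idfun R[i]) v).
Local Notation e_ l := (delta_mx 0 l).
Local Notation adH v := (lin1_mx (lie_bracket H v)).
Local Notation met := (killing_metric iota lambda).
Local Notation KM := (killing_mx GC).
Let ac := analytic_field_id R.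

Lemma dincl_row l : dincl iota (e_ l) = row l B.
Proof. by rewrite (dinclE sub) map_delta_mx rowE. Qed.

Lemma ad_conjugate v : map_mx rc (adH v) *m B = B *m ad GC (dincl iota v).
Proof.
apply/row_matrixP => l; rewrite !row_mul -map_row -dincl_row.
rewrite -bracket_ad -(dincl_bracket sub) (dinclE sub); congr (map_mx _ _ *m _).
by apply/rowP => j; rewrite !mxE.
Qed.

Lemma ad_real v : ad GC (dincl iota v) = invmx B *m map_mx rc (adH v) *m B.
Proof. by rewrite -mulmxA ad_conjugate mulKmx. Qed.

(** In the basis of the complex Lie algebra that comes from the real form, the
    adjoint representation of real vectors has real matrices. *)
Lemma killing_real v w :
  killing GC (dincl iota v) (dincl iota w) = (killing H v w)%:C%C.
Proof.
have -> : killing H v w = \tr (adH v *m adH w) by [].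
rewrite killing_ad !ad_real.
have -> : invmx B *m map_mx rc (adH v) *m B *m (invmx B *m map_mx rc (adH w) *m B) =
    invmx B *m (map_mx rc (adH v) *m map_mx rc (adH w) *m B).
  by rewrite !mulmxA mulmxK.
by rewrite mxtrace_mulC mulmxK// -map_mxM trace_map_mx.
Qed.

Lemma tr_ad_real v : \tr (ad GC (dincl iota v)) = (\tr (adH v))%:C%C.
Proof.
rewrite ad_real -mulmxA mxtrace_mulC -mulmxA mulmxV// mulmx1.
by rewrite trace_map_mx.
Qed.

Lemma metric_complex v w : (met v w)%:C%C =
  - lambda%:C%C * killing GC (dincl iota v) (dincl iota w).
Proof. by rewrite /killing_metric killing_real rmorphM rmorphN. Qed.

Lemma gram_complex : map_mx rc (gram met) = - lambda%:C%C *: (B *m KM *m B^T).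
Proof.
apply/matrixP => a b; rewrite [LHS]mxE [X in rc X]mxE [RHS]mxE metric_complex.
congr (_ * _); rewrite killingE !dincl_row -row_mul tr_row [LHS]mxE [RHS]mxE.
by apply: eq_bigr => k _; congr (_ * _); rewrite [LHS]mxE.
Qed.

Lemma metric_sum v w : met v w = \sum_l v 0 l * met (e_ l) w.
Proof.
apply: (@complexI R); rewrite [RHS]rmorph_sum /= metric_complex dinclE// mulmx_sum_row.
rewrite killingE mulmx_suml mulmx_suml summxE mulr_sumr.
apply: eq_bigr => l _; rewrite rmorphM /= metric_complex killingE dincl_row.
have scE (c : R[i]) (M : 'M[R[i]]_1) : (c *: M) 0 0 = c * M 0 0 by rewrite mxE.
by rewrite -!scalemxAl scE [(map_mx _ _) 0 l]mxE mulrCA.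
Qed.

Lemma metricC v w : met v w = met w v.
Proof. by rewrite /killing_metric (killingC GC (dincl iota v)). Qed.

Hypothesis KM_unit : KM \in unitmx.
Hypothesis lambda_neq0 : lambda != 0.

Lemma gram_unit : gram met \in unitmx.
Proof.
rewrite -(map_unitmx rc) gram_complex unitmxZ ?unitfE.
  by rewrite !unitmx_mul B_unit KM_unit unitmx_tr B_unit.
by rewrite oppr_eq0 fmorph_eq0.
Qed.

Local Notation gi := (invmx (gram met)).

Lemma inv_gramC a d : gi a d = gi d a.
Proof.
have -> : gi d a = (gi^T) a d by rewrite mxE.
rewrite trmx_inv; congr (invmx _ _ _).
by apply/matrixP => k l; rewrite !mxE metricC.
Qed.

Lemma inv_gram_metric v a : \sum_d gi a d * met v (e_ d) = v 0 a.
Proof.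
under eq_bigr do rewrite metric_sum mulr_sumr.
rewrite exchange_big /=.
transitivity (\sum_l v 0 l * (gram met *m gi) l a).
  apply: eq_bigr => l _; rewrite mxE mulr_sumr; apply: eq_bigr => d _.
  by rewrite [gram met l d]mxE inv_gramC; ring.
rewrite mulmxV ?gram_unit// (bigD1 a)//= big1 ?addr0 => [|l la].
  by rewrite mxE eqxx mulr1.
by rewrite mxE (negbTE la) mulr0.
Qed.

(** Of the three terms of Koszul's formula, two contribute half the trace of
    the adjoint representation each, and the third is antisymmetric. *)
Lemma christoffel_trace b :
  \sum_a christoffel H met a b a = - \tr (adH (e_ b)).
Proof.
have metN v w : met (- v) w = - met v w.
  by rewrite !(metric_sum _ w) -sumrN; apply: eq_bigr => l _; rewrite mxE mulNr.
have tr a : adH (e_ b) a a = lie_bracket H (e_ b) (e_ a) 0 a by rewrite mxE.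
pose T1 := \sum_a \sum_d gi a d * met (lie_bracket H (e_ a) (e_ b)) (e_ d).
pose T2 := \sum_a \sum_d gi a d * met (lie_bracket H (e_ b) (e_ d)) (e_ a).
pose T3 := \sum_a \sum_d gi a d * met (lie_bracket H (e_ d) (e_ a)) (e_ b).
pose t := \tr (adH (e_ b)).
have T30 : T3 = 0.
  have : T3 = - T3.
    rewrite {1}/T3 exchange_big -sumrN; apply: eq_bigr => a _ /=.
    rewrite -sumrN; apply: eq_bigr => d _.
    by rewrite inv_gramC bracket_anti metN mulrN.
  by lra.
have T1E : T1 = - t.
  rewrite /T1 /t /mxtrace -sumrN; apply: eq_bigr => a _.
  by rewrite inv_gram_metric bracket_anti mxE tr.
have T2E : T2 = t.
  rewrite /T2 exchange_big; apply: eq_bigr => d _ /=.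
  rewrite tr -inv_gram_metric; apply: eq_bigr => a _.
  by rewrite inv_gramC.
transitivity (2^-1 * (T1 - T2 + T3)).
  rewrite /T1 /T2 /T3 -sumrB -big_split /= mulr_sumr; apply: eq_bigr => a _.
  rewrite /christoffel -sumrB -big_split /=; congr (_ * _); apply: eq_bigr => d _.
  by rewrite mulrDr mulrBr.
by rewrite T1E T2E T30 -/t; lra.
Qed.

Definition inv_killing : 'M[R[i]]_m := invmx (- lambda%:C%C *: KM).

(** The Gram matrix of the real form is congruent to the complex one, so that
    the inverse metrics are the same bivector. *)
Lemma inv_killing_gram : inv_killing = B^T *m map_mx rc gi *m B.
Proof.
rewrite map_invmx gram_complex /inv_killing.
have u : - lambda%:C%C *: KM \in unitmx.
  by rewrite unitmxZ// unitfE oppr_eq0 fmorph_eq0.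
have BT : B^T \in unitmx by rewrite unitmx_tr.
have -> : - lambda%:C%C *: (B *m KM *m B^T) = B *m (- lambda%:C%C *: KM) *m B^T.
  by rewrite -scalemxAr -scalemxAl.
set N := - lambda%:C%C *: KM in u *.
have -> : invmx (B *m N *m B^T) = invmx B^T *m invmx N *m invmx B.
  apply: (can_inj (mulKmx (_ : B *m N *m B^T \in unitmx))).
    by rewrite !unitmx_mul B_unit u BT.
  rewrite mulmxV ?unitmx_mul ?B_unit ?u// -!mulmxA (mulmxA B^T) mulmxV// mul1mx.
  by rewrite (mulmxA N) mulmxV// mul1mx mulmxV.
by rewrite !mulmxA mulmxV// mul1mx mulmxKV.
Qed.

Lemma quadratic_sum (g : 'M[R[i]]_m) (P : 'I_m -> 'I_m -> R[i]) :
  \sum_(p : 'I_m * 'I_m) (B^T *m g *m B) p.1 p.2 * P p.1 p.2 =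
  \sum_a \sum_d g a d * \sum_j \sum_k B a j * B d k * P j k.
Proof.
rewrite -(pair_bigA _ (fun j k => (B^T *m g *m B) j k * P j k)) /=.
transitivity (\sum_j \sum_k \sum_a \sum_d g a d * (B a j * B d k * P j k)).
  apply: eq_bigr => j _; apply: eq_bigr => k _.
  rewrite mxE mulr_suml exchange_big /=; apply: eq_bigr => d _.
  rewrite mxE mulr_suml mulr_suml; apply: eq_bigr => a _.
  by rewrite mxE; ring.
under [RHS]eq_bigr => a _ do under eq_bigr => d _ do rewrite mulr_sumr.
under [RHS]eq_bigr => a _ do rewrite exchange_big.
rewrite [RHS]exchange_big /=; apply: eq_bigr => j _.
under [RHS]eq_bigr => a _ do under eq_bigr => d _ do rewrite mulr_sumr.
under [RHS]eq_bigr => a _ do rewrite exchange_big.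
by rewrite [RHS]exchange_big.
Qed.

(** On restrictions of holomorphic functions, the Laplace-Beltrami operator of
    the real form is the restriction of one and the same operator, because all
    data are expressed by the complex bracket and the complex Killing form. *)
Lemma natural_laplacian (WC : set GC) (W : set H) (F : GC -> R[i]) (f : H -> R[i]) :
  open W -> holo_on WC F -> (forall g, W g -> WC (iota g) /\ f g = F (iota g)) ->
  forall g, W g ->
    laplace_beltrami met f g = complex_laplacian inv_killing F (iota g).
Proof.
move=> Wo FW fF g Wg; have [WCg _] := fF _ Wg.
have Wnear z : W z -> \forall x \near z, W x.
  by move=> Wz; exact: open_nbhs_nbhs.
have natD v (F' : GC -> R[i]) f' z : holo_on WC F' -> (forall x, W x -> f' x = F' (iota x)) ->
    W z -> D v f' z = DC (dincl iota v) F' (iota z).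
  move=> F'W f'F' Wz.
  have := holo_at_lexp ac (F'W _ (fF _ Wz).1); set d := \row_l _ => Fd.
  apply: (natural_lderiv sub v Fd).
  by apply: filterS (Wnear _ Wz) => x; exact: f'F'.
pose b a := dincl iota (e_ a).
pose VC c x := \sum_d (gi c d)%:C%C * DC (b d) F x.
have VCE c z : W z -> gradient met f c z = VC c (iota z).
  move=> Wz; apply: eq_bigr => d _; congr (_ * _).
  by apply: natD => // x Wx; have [] := fF _ Wx.
have VCW c : holo_on WC (VC c).
  by move=> x WCx; apply: holo_at_sum => d; exact: holo_on_lderiv WCx.
pose E j k := DC (e_ j) (DC (e_ k) F) (iota g).
pose E1 k := DC (e_ k) F (iota g).
have bE a j : b a 0 j = B a j by rewrite /b dincl_row mxE.
have DbE a F' : holo_at (@idfun R[i]) F' (iota g) ->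
    DC (b a) F' (iota g) = \sum_j B a j * DC (e_ j) F' (iota g).
  by move=> /(lderiv_basis ac (b a)) ->; apply: eq_bigr => j _; rewrite bE.
have DDbE a d : DC (b a) (DC (b d) F) (iota g) = \sum_j \sum_k B a j * B d k * E j k.
  have N : \forall x \near iota g, DC (b d) F x = \sum_k B d k * DC (e_ k) F x.
    have := near_lexp ac (FW _ WCg); apply: filterS => x [e Fe].
    by rewrite (lexp_basis ac (b d) Fe); apply: eq_bigr => j _; rewrite bE.
  have h := holo_on_lderiv (b d) FW WCg.
  have := lderiv_near ac (b a) N h => ->.
  have hk k := holo_on_lderiv (e_ k) FW WCg.
  have := @lderiv_sum _ _ _ ac _ _ (b a) _ (index_enum 'I_m) (fun k => B d k)
    (fun k => DC (e_ k) F) (iota g) hk => ->.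
  rewrite exchange_big /=; apply: eq_bigr => k _; rewrite DbE; last exact: hk.
  by rewrite mulr_sumr; apply: eq_bigr => j _; rewrite /E; ring.
have DVE a : D (e_ a) (gradient met f a) g =
    \sum_d (gi a d)%:C%C * \sum_j \sum_k B a j * B d k * E j k.
  rewrite (natD _ (VC a))//; last by move=> x; exact: VCE.
  have := @lderiv_sum _ _ _ ac _ _ (b a) _ (index_enum 'I_m) (fun d => (gi a d)%:C%C)
    (fun d => DC (b d) F) (iota g) (fun d => holo_on_lderiv (b d) FW WCg) => ->.
  by apply: eq_bigr => d _; rewrite DDbE.
pose t j := \tr (ad GC (e_ j)).
have Gamma c : (\sum_a christoffel H met a c a)%:C%C = - \sum_j B c j * t j.
  rewrite christoffel_trace rmorphN /= -tr_ad_real tr_ad; congr (- _).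
  by apply: eq_bigr => j _; rewrite dincl_row mxE.
rewrite /laplace_beltrami /divergence big_split /=.
under eq_bigr do rewrite DVE.
rewrite [X in _ + X]exchange_big /=.
transitivity (\sum_a \sum_d (gi a d)%:C%C * \sum_j \sum_k B a j * B d k * E j k +
  \sum_a (- \sum_j B a j * t j) * (\sum_d (gi a d)%:C%C * \sum_k B d k * E1 k)).
  congr (_ + _); apply: eq_bigr => c _; rewrite -Gamma rmorph_sum mulr_suml.
  apply: eq_bigr => a _ /=; congr (_ * _); rewrite VCE//; apply: eq_bigr => d _.
  by rewrite DbE//; exact: FW.
rewrite -big_split /= /complex_laplacian inv_killing_gram.
rewrite (quadratic_sum _ (fun j k => - t j * E1 k + E j k)).
apply: eq_bigr => a _; rewrite mulr_sumr -big_split; apply: eq_bigr => d _ /=.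
rewrite [(map_mx _ _) a d]mxE mulrCA -mulrDr; congr (_ * _).
rewrite mulNr mulr_suml -sumrN -big_split; apply: eq_bigr => j _ /=.
rewrite mulr_sumr -sumrN -big_split; apply: eq_bigr => k _ /=.
by ring.
Qed.

End RealForm.

(** * Functions that vanish to infinite order *)

Section FlatFamilies.
Variables (R : realType) (n : nat).

(** Where the frame is invertible, the coordinate derivatives of a function are
    controlled by its derivatives along the frame. *)
Lemma frame_inverse_bound (A : 'I_n -> 'I_n -> 'rV[R[i]]_n -> R[i]) a :
  (forall l k, holo (A l k) a) -> \matrix_(l, k) A l k a \in unitmx ->
  exists2 c : R, 0 <= c & \forall r \near 0^'+, forall u, inbox r u ->
    forall (g : 'rV[R[i]]_n) (q : R),
      (forall l, cmod (\sum_k A l k (a + u) * g 0 k) <= q) -> inbox (c * q) g.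
Proof.
move=> hA; set A0 := \matrix_(l, k) _ => A0u; pose Ai := invmx A0.
have [b b0 Ab] : exists2 b : R, 0 <= b & forall k l, cmod (Ai k l) <= b.
  exists (\sum_k \sum_l cmod (Ai k l)) => [|k l].
    by apply: sumr_ge0 => k _; apply: sumr_ge0 => l _; exact: cmod_ge0.
  rewrite (bigD1 k)//= (bigD1 l)//= -addrA lerDl addr_ge0//.
    by apply: sumr_ge0 => l' _; exact: cmod_ge0.
  by apply: sumr_ge0 => k' _; apply: sumr_ge0 => l' _; exact: cmod_ge0.
have [L L0 hL] : exists2 L : R, 0 <= L & \forall r \near 0^'+,
    forall p : 'I_n * 'I_n, forall u, inbox r u ->
      cmod (A p.1 p.2 (a + u) - A p.1 p.2 a) <= L * `|r|.
  apply: (uniform_bound (P := fun (p : 'I_n * 'I_n) L r => forall u, inbox r u ->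
      cmod (A p.1 p.2 (a + u) - A p.1 p.2 a) <= L * `|r|)).
    by move=> p B B' s BB' h k ks; rewrite (le_trans (h k ks))// ler_wpM2r.
  move=> p; have [L hL] := qdiff_continuous (holo_qdiff (hA p.1 p.2)).
  exists L; near=> r => u ur; rewrite gtr0_norm; last by near: r; exact: nbhs_right_gt.
  by move: u ur; near: r.
pose N : R := n%:R; have N0 : 0 <= N by rewrite ler0n.
exists (2 * (N * (N * b))); first by rewrite !mulr_ge0.
have bL : 0 < N * (N * (b * L)) + 1 by rewrite ltr_wpDl// !mulr_ge0.
near=> r => u ur g q pq.
have r0 : 0 < r by near: r; exact: nbhs_right_gt.
have rs : r * (N * (N * (b * L)) + 1) <= 2^-1.
  by rewrite -ler_pdivlMr//; near: r; apply: nbhs_right_le; rewrite divr_gt0.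
have AL l k : cmod (A l k (a + u) - A l k a) <= L * r.
  rewrite -(gtr0_norm r0).
  have h : forall p : 'I_n * 'I_n, forall u, inbox r u ->
      cmod (A p.1 p.2 (a + u) - A p.1 p.2 a) <= L * `|r| by near: r.
  exact: (h (l, k)).
(* A0 g = A(a + u) g - (A(a + u) - A0) g; the last term contributes at most S / 2
   to the bound on S obtained by inverting A0, and is absorbed. *)
pose S := \sum_k cmod (g 0 k).
have S0 : 0 <= S by apply: sumr_ge0 => k _; exact: cmod_ge0.
have gk k : cmod (g 0 k) <= N * (b * (q + L * r * S)).
  pose p l := \sum_k A l k (a + u) * g 0 k.
  have -> : g 0 k = \sum_l Ai k l * (p l - \sum_k' (A l k' (a + u) - A l k' a) * g 0 k').
    have : Ai *m (A0 *m g^T) = g^T by rewrite mulKmx.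
    move/matrixP => /(_ k 0); rewrite [g^T k 0]mxE => <-; rewrite mxE.
    apply: eq_bigr => l _; congr (_ * _); rewrite mxE /p -sumrB.
    by apply: eq_bigr => k' _; rewrite !mxE; ring.
  apply: le_trans (cmod_sum _ _ _) _.
  have -> : N * (b * (q + L * r * S)) = \sum_(l < n) b * (q + L * r * S).
    by rewrite sumr_const card_ord mulr_natl.
  apply: ler_sum => l _; rewrite Normc.normcM ler_pM ?cmod_ge0//.
  apply: le_trans (le_cmodB _ _) _; rewrite lerD//; first exact: pq.
  apply: le_trans (cmod_sum _ _ _) _; rewrite /S mulr_sumr.
  by apply: ler_sum => k' _; rewrite Normc.normcM ler_wpM2r ?cmod_ge0.
have S1 : S <= N * (N * (b * (q + L * r * S))).
  have -> : N * (N * (b * (q + L * r * S))) = \sum_(k < n) N * (b * (q + L * r * S)).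
    by rewrite sumr_const card_ord mulr_natl.
  exact: ler_sum.
have S2 : S <= 2 * (N * (N * b)) * q.
  have : r * (N * (N * (b * L)) + 1) * S <= 2^-1 * S by rewrite ler_wpM2r.
  have : 0 <= r * S by rewrite mulr_ge0// ltW.
  have -> : r * (N * (N * (b * L)) + 1) * S = N * (N * (b * (L * r * S))) + r * S by ring.
  have E : N * (N * (b * (q + L * r * S))) = N * (N * b) * q + N * (N * (b * (L * r * S))) by ring.
  rewrite E in S1; rewrite -(mulrA 2); move: S1.
  set X := N * (N * (b * (L * r * S))); set Y := N * (N * b) * q; set Z := r * S.
  by lra.
move=> k; apply: le_trans S2; rewrite /S (bigD1 k)//= lerDl.
by apply: sumr_ge0 => k' _; exact: cmod_ge0.
Unshelve. all: by end_near. Qed.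

(** A family of functions that vanish at [a] and is stable under an invertible
    frame of derivations vanishes to infinite order, hence near [a]. *)
Lemma flat_family (P : seq 'I_n -> 'rV[R[i]]_n -> R[i]) A a :
  (forall l k, holo (A l k) a) -> \matrix_(l, k) A l k a \in unitmx ->
  (forall s, holo (P s) a) -> (forall s, P s a = 0) ->
  (forall l s, \forall x \near boxnbhs a,
      P (l :: s) x = \sum_k A l k x * grad (P s) x 0 k) ->
  forall s, \forall x \near boxnbhs a, P s x = 0.
Proof.
move=> hA Au hP P0 PD s; apply: flat_zero => // m; elim: m s => [|m IH] s.
  have [L hL] := qdiff_continuous (holo_qdiff (hP s)); exists `|L|.
  near=> r => u ur; rewrite expr0 mulr1.
  have r0 : 0 < r by near: r; exact: nbhs_right_gt.
  have r1 : r <= 1 by near: r; apply: nbhs_right_le.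
  rewrite -[P s _]subr0 -(P0 s); apply: (@le_trans _ _ (L * r)).
    by move: u ur; near: r.
  by have := ler_norm L; have := normr_ge0 L; nra.
have [M M0 hM] : exists2 M : R, 0 <= M & \forall r \near 0^'+, forall l u,
    inbox r u -> cmod (P (l :: s) (a + u)) <= M * `|r| ^+ m.
  apply: (uniform_bound (P := fun l M r => forall u,
    inbox r u -> cmod (P (l :: s) (a + u)) <= M * `|r| ^+ m)).
    by move=> l B B' r BB' h k ks; rewrite (le_trans (h k ks))// ler_wpM2r// exprn_ge0.
  move=> l; have [M hM] := IH (l :: s); exists M; near=> r => u ur.
  rewrite gtr0_norm; last by near: r; exact: nbhs_right_gt.
  by move: u ur; near: r.
have [c c0 hc] := frame_inverse_bound hA Au.
have hPD : \forall r \near 0^'+, forall l u, inbox r u ->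
    P (l :: s) (a + u) = \sum_k A l k (a + u) * grad (P s) (a + u) 0 k.
  apply: filter_forall => l; exact: (boxnbhs_box (PD l s)).
have hG : \forall r \near 0^'+, forall u, inbox r u ->
    inbox (c * (M * r ^+ m)) (grad (P s) (a + u)).
  near=> r => u ur.
  have h1 : forall u, inbox r u -> forall (g : 'rV[R[i]]_n) (q : R),
      (forall l, cmod (\sum_k A l k (a + u) * g 0 k) <= q) -> inbox (c * q) g by near: r.
  apply: h1 (ur) _ _ _ => l.
  have h2 : forall l u, inbox r u ->
    P (l :: s) (a + u) = \sum_k A l k (a + u) * grad (P s) (a + u) 0 k by near: r.
  rewrite -h2// -(@gtr0_norm _ r); last by near: r; exact: nbhs_right_gt.
  by move: l u ur {h2}; near: r.
have hGs := near_scale (ltr0Sn R 1) hG.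
have [d d0 hd] := mean_value (hP s).
exists (2 * (n%:R * (c * (M * 2 ^+ m)))); near=> r => u ur.
have r0 : 0 < r by near: r; exact: nbhs_right_gt.
have rd : r <= d by near: r; apply: nbhs_right_le.
have hG2 : forall u, inbox (r * 2) u -> inbox (c * (M * (r * 2) ^+ m)) (grad (P s) (a + u)).
  by near: r; exact: hGs.
have au : a + u - a = u by rewrite addrC addKr.
have := hd (a + u) r (c * (M * (r * 2) ^+ m)); rewrite r0 rd au P0 subr0.
move=> /(_ isT ur) h; apply: le_trans (h _) _ => [y ya|].
  have -> : y = a + (y - a) by rewrite addrC subrK.
  by apply: hG2; rewrite mulrC.
by rewrite exprMn exprS le_eqVlt; apply/orP; left; apply/eqP; ring.
Unshelve. all: by end_near. Qed.

End FlatFamilies.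

(** * The identity theorem *)

Section IdentityTheorem.
Variables (R : realType) (m : nat) (GC : lieGroupType R[i] m).
Local Notation DC v := (lderiv (L := R[i]) (@idfun R[i]) v).
Local Notation e_ l := (delta_mx 0 l).
Local Notation ct g := (chart_fun (chart_at g) g).
Let ac := analytic_field_id R.
Implicit Types z : GC.

Lemma near_complexP (a : 'rV[R[i] : numFieldType]_m) (P : set 'rV[R[i]]_m) :
  (\forall x \near a, P x) <-> boxnbhs a P.
Proof.
have E := nbhs_box a P (isometric_id R); split.
  by move=> /E[d d0 dP]; exists d => // x xa; apply: dP; rewrite map_mx_id.
by move=> [d d0 dP]; apply/E; exists d => // x xa; apply: dP; rewrite map_mx_id in xa.
Qed.

Lemma holo_at_chart (F : GC -> R[i]) z : holo_at (@idfun R[i]) F z ->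
  holo (F \o chart_inv (chart_at z)) (ct z).
Proof.
move=> [Phi hPhi FPhi]; rewrite map_mx_id// in hPhi.
apply: holo_ext hPhi; apply/near_complexP.
by apply: filterS FPhi => x /= ->; rewrite map_mx_id.
Qed.

Lemma near_chart_fun (z : GC) (P : set 'rV[R[i]]_m) : boxnbhs (ct z) P ->
  \forall x \near z, chart_dom (chart_at z) x /\ P (chart_fun (chart_at z) x).
Proof.
move=> /near_complexP aP; have := chart_fun_continuous (chart_at_dom z) aP => h.
have dz : \forall z' \near z, chart_dom (chart_at z) z'.
  by apply: open_nbhs_nbhs; split; [exact: open_chart_dom|exact: chart_at_dom].
by apply: filterS2 dz h => x; split.
Qed.

Lemma holo_at_neq0 (F : GC -> R[i]) z : holo_at (@idfun R[i]) F z -> F z != 0 ->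
  \forall x \near z, F x != 0.
Proof.
move=> /holo_at_chart hP Fz; set P := F \o _ in hP.
have Pa : P (ct z) = F z by rewrite /P /= chart_invK_at.
have c0 : 0 < cmod (F z).
  rewrite lt0r cmod_ge0 andbT; apply: contra Fz => /eqP/Normc.eq0_normc ->.
  exact: eqxx.
have [L hL] := qdiff_continuous (holo_qdiff hP).
have : boxnbhs (ct z) (fun x => P x != 0).
  have Lc : 0 < `|L| + 1 by rewrite ltr_wpDl.
  near (0:R)^'+ => r; exists r; first by near: r; exact: nbhs_right_gt.
  move=> x xr; apply/eqP => Px.
  have : cmod (P (ct z + (x - ct z)) - P (ct z)) <= L * r.
    by move: (x - ct z) xr; near: r.
  have -> : ct z + (x - ct z) = x by rewrite addrC subrK.
  rewrite Px sub0r normcN Pa.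
  have r0 : 0 < r by near: r; exact: nbhs_right_gt.
  have : r < cmod (F z) / (`|L| + 1).
    by near: r; apply: nbhs_right_lt; rewrite divr_gt0.
  rewrite ltr_pdivlMr//; have := ler_norm L; nra.
move=> /near_chart_fun; apply: filterS => x [xd].
by rewrite /P /= chart_funK.
Unshelve. all: by end_near. Qed.

Definition iter_deriv (F : GC -> R[i]) (s : seq 'I_m) : GC -> R[i] :=
  foldr (fun l F => DC (e_ l) F) F s.

Lemma iter_deriv_near0 (F : GC -> R[i]) s z :
  (\forall x \near z, F x = 0) -> \forall x \near z, iter_deriv F s x = 0.
Proof.
move=> F0; elim: s => [//|l s IH] /=.
apply: filterS (nbhs_interior IH) => x Fx.
have Fx0 : \forall y \near x, (fun=> 0 : R[i]) y = iter_deriv F s y.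
  by apply: filterS Fx => y ->.
rewrite (lexp_lderiv ac.1 (e_ l) (lexp_ext Fx0 (lexp0 _ _))).
by rewrite /dot big1// => j _; rewrite [X in _ * X]mxE mulr0.
Qed.

Variables (WC : set GC) (F : GC -> R[i]).
Hypothesis WC_open : open WC.
Hypothesis F_holo : holo_on WC F.

Lemma holo_on_iter_deriv s : holo_on WC (iter_deriv F s).
Proof.
elim: s => [|l s IH]; first exact: F_holo.
exact: (holo_on_lderiv (e_ l) IH).
Qed.

Definition flat_at z := WC z /\ forall s, iter_deriv F s z = 0.

Lemma flat_near0 z : flat_at z -> \forall x \near z, F x = 0.
Proof.
move=> [Wz Fz]; have [A hA] := frame_exists ac z.
pose P s := iter_deriv F s \o chart_inv (chart_at z).
have hP s : holo (P s) (ct z) := holo_at_chart (holo_on_iter_deriv s Wz).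
have aE : map_mx (@idfun R[i]) (ct z) = ct z by rewrite map_mx_id.
have hA1 l k : holo (A l k) (ct z) by have := hA.1 l k; rewrite aE.
have hA2 : \matrix_(l, k) A l k (ct z) \in unitmx.
  by have := frame_unit ac hA; rewrite aE.
have P0 s : P s (ct z) = 0 by rewrite /P /= chart_invK_at.
have PD l s : \forall x \near boxnbhs (ct z),
    P (l :: s) x = \sum_k A l k x * grad (P s) x 0 k.
  apply/near_complexP.
  have hPs : holo (P s) (map_mx (@idfun R[i]) (ct z)) by rewrite aE.
  have PE : \forall x \near ct z, iter_deriv F s (chart_inv (chart_at z) x) =
      P s (map_mx (@idfun R[i]) x).
    by near=> x; rewrite map_mx_id.
  have := lderiv_frame ac hA hPs PE (e_ l); apply: filterS => x xE.
  apply: (etrans xE).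
  rewrite map_mx_id// /frame_deriv (bigD1 l)//= [X in _ + X]big1 ?addr0 => [|j jl].
    by rewrite mxE !eqxx /= mul1r.
  by rewrite mxE eqxx (negbTE jl) /= mul0r.
have := flat_family hA1 hA2 hP P0 PD [::] => /near_chart_fun.
by apply: filterS => x [xd]; rewrite /P /= chart_funK.
Unshelve. all: by end_near. Qed.

Lemma open_flat : open flat_at.
Proof.
rewrite openE => z fz; have [Wz _] := fz.
have Wn : \forall x \near z, WC x by exact: open_nbhs_nbhs.
have := nbhs_interior (flat_near0 fz); apply: filterS2 Wn => x Wx Fx.
by split=> // s; exact: nbhs_singleton (iter_deriv_near0 s Fx).
Qed.

Lemma closed_flat z : WC z -> closure flat_at z -> flat_at z.
Proof.
move=> Wz cz; split=> // s; apply/eqP/negPn/negP => Fz.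
have [x [[_ /(_ s) Fx] /=]] := cz _ (holo_at_neq0 (holo_on_iter_deriv s Wz) Fz).
by rewrite Fx eqxx.
Qed.

(** The points where all iterated derivatives vanish form a set that is closed
    by continuity and open because the function is zero near each of them. *)
Lemma identity_component z0 z : flat_at z0 -> connected_component WC z0 z -> F z = 0.
Proof.
move=> f0 z0z; have W0 := f0.1.
have sub : connected_component WC z0 `<=` WC by exact: connected_component_sub.
have : connected_component WC z0 `&` flat_at = connected_component WC z0.
  apply: (component_connected (A := WC) (x := z0)).
  - by exists z0; split=> //; exact: connected_component_refl.
  - by exists flat_at => //; exact: open_flat.
  - exists (closure flat_at); first exact: closed_closure.
    apply/seteqP; split=> x [cx fx]; split=> //; first exact: subset_closure.
    by apply: closed_flat fx; exact: sub.
by move=> /seteqP[_ /(_ _ z0z)[_ /flat_near0/nbhs_singleton]].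
Qed.

(** A real form determines all iterated derivatives at its points: its tangent
    vectors span the complex Lie algebra, and the derivations depend
    complex-linearly on the vector. *)
Lemma vanish_real_form (H : lieGroupType R m) (iota : H -> GC) (W : set H) :
  lie_subgroup iota -> dincl_mx iota \in unitmx -> open W ->
  (forall g, W g -> WC (iota g)) ->
  (forall z, WC z -> connected_component WC z `&` iota @` W !=set0) ->
  (forall g, W g -> F (iota g) = 0) <-> (forall z, WC z -> F z = 0).
Proof.
move=> sub Bu Wo WWC meet; split=> [F0 z Wz|F0 g /WWC /F0 //].
have flat g : W g -> flat_at (iota g).
  move=> Wg; split=> [|s]; first exact: WWC.
  elim: s g Wg => [|l s IH] g Wg; first exact: F0.
  have hF := holo_on_iter_deriv s (WWC _ Wg).
  have F0g : \forall x \near g, (fun=> 0 : R[i]) x = iter_deriv F s (iota x).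
    have Wn : \forall x \near g, W x by exact: open_nbhs_nbhs.
    by apply: filterS Wn => x /IH ->.
  pose u : 'cV[R[i]]_m := \col_j DC (e_ j) (iter_deriv F s) (iota g).
  have Bv : dincl_mx iota *m u = 0.
    apply/colP => a; rewrite [RHS]mxE.
    have := natural_lderiv sub (e_ a) (holo_at_lexp ac hF) F0g.
    rewrite (lexp_lderiv (analytic_field_real R).1 _ (lexp0 _ _)) /dot.
    rewrite big1 => [|j _]; last by rewrite [X in _ * X]mxE mulr0.
    rewrite (lderiv_basis ac (dincl iota (e_ a)) hF) => E; rewrite mxE [RHS]E.
    by apply: eq_bigr => j _; rewrite [u j 0]mxE (dincl_row sub) [in RHS]mxE.
  have : u = 0 by rewrite -(mulKmx Bu u) Bv mulmx0.
  by move=> /colP/(_ l); rewrite !mxE.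
have [x [zx [g Wg gE]]] := meet z Wz; rewrite -gE in zx.
exact: (identity_component (flat g Wg) (connected_component_sym zx)).
Qed.

End IdentityTheorem.

(** * Duality *)

Lemma iter_natural_laplacian (R : realType) (m : nat) (GC : lieGroupType R[i] m)
    (H : lieGroupType R m) (iota : H -> GC) (lambda : R)
    (WC : set GC) (F : GC -> R[i]) (W : set H) (f : H -> R[i]) (r : nat) :
  lie_subgroup iota -> dincl_mx iota \in unitmx -> killing_mx GC \in unitmx ->
  lambda != 0 -> open W -> holo_on WC F ->
  (forall g, W g -> WC (iota g) /\ f g = F (iota g)) ->
  forall g, W g -> iter r (laplace_beltrami (killing_metric iota lambda)) f g =
    iter r (complex_laplacian (inv_killing GC lambda)) F (iota g).
Proof.
move=> sub Bu Ku l0 Wo FW fF.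
have hol k : holo_on WC (iter k (complex_laplacian (inv_killing GC lambda)) F).
  by elim: k => [//|k IH]; exact: holo_on_laplacian IH.
elim: r => [|r IH] g Wg; first by have [] := fF g Wg.
apply: (natural_laplacian sub Bu Ku l0 Wo (hol r)) => // x Wx.
by have [WCx _] := fF x Wx; split=> //; exact: IH.
Qed.

Lemma proper_harmonic_complex (R : realType) (m : nat) (GC : lieGroupType R[i] m)
    (H : lieGroupType R m) (iota : H -> GC) (lambda : R)
    (WC : set GC) (F : GC -> R[i]) (W : set H) (f : H -> R[i]) (r : nat) :
  lie_subgroup iota -> dincl_mx iota \in unitmx -> killing_mx GC \in unitmx ->
  lambda != 0 -> open WC -> open W -> holo_on WC F ->
  (forall g, W g -> WC (iota g) /\ f g = F (iota g)) ->
  (forall z, WC z -> connected_component WC z `&` iota @` W !=set0) ->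
  proper_harmonic (killing_metric iota lambda) r W f <->
  (forall z, WC z -> iter r (complex_laplacian (inv_killing GC lambda)) F z = 0) /\
  ~ (forall z, WC z -> iter r.-1 (complex_laplacian (inv_killing GC lambda)) F z = 0).
Proof.
move=> sub Bu Ku l0 WCo Wo FW fF meet.
have vanish k :
    (forall g, W g -> iter k (laplace_beltrami (killing_metric iota lambda)) f g = 0) <->
    (forall z, WC z -> iter k (complex_laplacian (inv_killing GC lambda)) F z = 0).
  have hol : holo_on WC (iter k (complex_laplacian (inv_killing GC lambda)) F).
    by elim: k => [//|k IH]; exact: holo_on_laplacian IH.
  have E := vanish_real_form WCo hol sub Bu Wo (fun g Wg => (fF g Wg).1) meet.
  rewrite -E; split=> F0 g Wg; have := F0 g Wg;
    by rewrite (iter_natural_laplacian _ sub Bu Ku l0 Wo FW fF).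
by split=> -[h1 h2]; (split; [exact/vanish|by move/vanish]).
Qed.

Lemma dincl_mx_unit (R : realType) (m : nat) (GC : lieGroupType R[i] m)
    (H : lieGroupType R m) (iota : H -> GC) : lie_subgroup iota ->
  (forall z : 'rV[R[i]]_m, (z <= dincl_mx iota)%MS) -> dincl_mx iota \in unitmx.
Proof.
move=> sub full; rewrite -row_full_unit -sub1mx; apply/row_subP => j.
exact: full.
Qed.

Lemma dincl_sub (R : realType) (n m : nat) (GC : lieGroupType R[i] m)
    (H : lieGroupType R n) (iota : H -> GC) v : lie_subgroup iota ->
  (dincl iota v <= dincl_mx iota)%MS.
Proof. by move=> sub; rewrite dinclE// submxMl. Qed.

(** In the basis that comes from the real form, the complex Killing matrix is the
    real one. *)
Lemma killing_mx_unit (R : realType) (m : nat) (GC : lieGroupType R[i] m)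
    (H : lieGroupType R m) (iota : H -> GC) : lie_subgroup iota ->
  dincl_mx iota \in unitmx -> semisimple H -> killing_mx GC \in unitmx.
Proof.
move=> sub Bu ss; set B := dincl_mx iota in Bu *; set KM := killing_mx GC.
pose KH : 'M[R]_m := \matrix_(a, b) killing H (delta_mx 0 a) (delta_mx 0 b).
have KHE : map_mx (real_complex R) KH = B *m KM *m B^T.
  apply/matrixP => a b; rewrite [LHS]mxE [X in real_complex R X]mxE.
  have <- := killing_real sub Bu (delta_mx 0 a) (delta_mx 0 b).
  rewrite killingE !(dincl_row sub) -row_mul tr_row [LHS]mxE [RHS]mxE.
  by apply: eq_bigr => k _; congr (_ * _); rewrite [LHS]mxE.
have KHu : KH \in unitmx.
  rewrite -row_free_unit -kermx_eq0; apply/eqP/row_matrixP => a.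
  rewrite row0; apply: ss => w; apply: (@complexI R).
  have <- := killing_real sub Bu (row a (kermx KH)) w.
  rewrite killingE !(dinclE sub) trmx_mul !mulmxA.
  rewrite -(mulmxA (map_mx _ _) B) -(mulmxA (map_mx _ _) _ B^T) -KHE -map_mxM.
  by rewrite -row_mul mulmx_ker row0 map_mx0 mul0mx mxE.
have : map_mx (real_complex R) KH \in unitmx by rewrite map_unitmx.
by rewrite KHE !unitmx_mul => /andP[/andP[_ ->]].
Qed.

Theorem theorem8p1 (R : realType) (m : nat)
    (GC : lieGroupType R[i] m) (G U : lieGroupType R m)
    (iG : G -> GC) (iU : U -> GC)
    (kk pp : 'M[R]_m) (K : set G) (lambda : R)
    (W : set G) (f : G -> R[i]) (Ws : set U) (fs : U -> R[i]) (r : nat)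
    (G_noncompact : ~ compact [set: G])
    (G_semisimple : semisimple G)
    (kp_cartan : cartan_decomposition G kk pp)
    (K_maximal : maximal_compact K)
    (K_lie : forall v : 'rV[R]_m, lie_algebra_of K v <-> (v <= kk)%MS)
    (GC_complexification : complexification iG)
    (U_subgroup : lie_subgroup iU)
    (U_compact : compact [set: U])
    (U_lie : forall z : 'rV[R[i]]_m,
       (exists u, z = dincl iU u) <->
       (exists x y, [/\ (x <= kk)%MS, (y <= pp)%MS &
                        z = dincl iG x + 'i%C *: dincl iG y]))
    (lambda_gt0 : 0 < lambda)
    (W_open : open W)
    (f_analytic : analytic_on (real_complex R) W f)
    (fs_dual : dual_function iG iU W f Ws fs)
    (r_gt0 : (0 < r)%N) :
  proper_harmonic (killing_metric iG lambda) r W f <->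
  proper_harmonic (killing_metric iU lambda) r Ws fs.
Proof.
have [G_subgroup GC_sum] := GC_complexification.
have [[kp_sum _] _ _ _ _] := kp_cartan.
have BG : dincl_mx iG \in unitmx.
  apply: dincl_mx_unit => // z; have [[x y] [/= -> _]] := GC_sum z.
  by rewrite addmx_sub// ?scalemx_sub// dincl_sub.
have BU : dincl_mx iU \in unitmx.
  apply: dincl_mx_unit => // z; have [[x y] [/= -> _]] := GC_sum z.
  have dincl0 : dincl iG 0 = 0 by rewrite dinclE// map_mx0 mul0mx.
  (* The complex span of u = k + ip contains k and ip, hence p. *)
  have in_U v : (dincl iG v <= dincl_mx iU)%MS.
    have /sub_addsmxP[[a b] /= ->] : (v <= kk + pp)%MS.
      by have /andP[_ h] := kp_sum; apply: submx_trans h; exact: submx1.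
    rewrite dinclE// map_mxD mulmxDl -!dinclE//; apply: addmx_sub.
      have [|u ->] := (U_lie (dincl iG (a *m kk))).2; last exact: dincl_sub.
      by exists (a *m kk), 0; rewrite submxMl sub0mx dincl0 scaler0 addr0.
    have [|u uE] := (U_lie ('i%C *: dincl iG (b *m pp))).2.
      by exists 0, (b *m pp); rewrite submxMl sub0mx dincl0 add0r.
    have -> : dincl iG (b *m pp) = - 'i%C *: dincl iU u.
      by rewrite -uE scalerA mulNr -expr2 sqr_i opprK scale1r.
    by apply: scalemx_sub; exact: dincl_sub.
  by rewrite addmx_sub// scalemx_sub.
have KMu := killing_mx_unit G_subgroup BG G_semisimple.
have l0 : lambda != 0 by rewrite gt_eqF.
have [WC [fC [[WC_open fC_analytic] WfC meet WsE fsE]]] := fs_dual.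
have fC_holo : holo_on WC fC.
  by move=> z Wz; have := analytic_holo_at (analytic_field_id R) fC_analytic Wz.
have Ws_open : open Ws.
  rewrite WsE; have [_ _ iU_cont _ _] := U_subgroup.
  by apply: open_comp => // x _; exact: iU_cont.
have fWC g : W g -> WC (iG g) /\ f g = fC (iG g).
  by move=> /WfC[? <-].
have fsWC u : Ws u -> WC (iU u) /\ fs u = fC (iU u).
  by move=> Wu; split; [move: Wu; rewrite WsE|exact: fsE].
have meetG z : WC z -> connected_component WC z `&` iG @` W !=set0.
  by move=> /meet[].
have meetU z : WC z -> connected_component WC z `&` iU @` Ws !=set0.
  move=> /meet[_ [x [zx [u _ uE]]]]; rewrite -uE in zx.
  exists (iU u); split=> //; exists u => //.
  by rewrite WsE; exact: (connected_component_sub zx).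
rewrite (proper_harmonic_complex r G_subgroup BG KMu l0 WC_open W_open fC_holo fWC meetG).
by rewrite (proper_harmonic_complex r U_subgroup BU KMu l0 WC_open Ws_open fC_holo fsWC meetU).
Qed.
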